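(* For any Neumann data $b_N<0$ there exists a unique self-similar solution of the Stefan–Neumann problem, where uniqueness is among the self-similar solutions of all types $n\in\{0,\ldots,m\}$. The type $n\in\{0,\ldots,m\}$ of this solution is determined by the condition $\gamma_n<-b_N\le\gamma_{n+1}$.
   Context: Data: an integer $m\ge 1$; real numbers $u_0\le u_1<u_2<\cdots<u_m$ and $u_{m+1}=+\infty$; constants $a_i>0$, $k_i>0$ ($i=0,\ldots,m$) and $d_i\ge 0$ ($i=1,\ldots,m$), with $d_1>0$ if $u_0=u_1$; a constant $b_N<0$. Put $F(\xi)=\frac{1}{\sqrt{\pi}}\int_0^\xi e^{-s^2/4}\,ds$, with $F(+\infty)=1$. Let $\alpha$ be the continuous function on $[u_0,+\infty)$ that is linear on each interval $(u_i,u_{i+1})$ with slope $k_i$, $i=0,\ldots,m$. Stefan–Neumann problem: find a continuous piecewise smooth function $u=u(t,x)$ on $\{t>0,\ x>0\}$ such that $u_t=a_i^2u_{xx}$ (classically) in each domain where $u_i<u<u_{i+1}$; on each phase transition line $x=x_i(t)$ where $u=u_i$, $i\geq 1$, the Stefan condition $d_i x_i'(t)+k_iu_x(t,x_i(t)+)-k_{i-1}u_x(t,x_i(t)-)=0$ holds, where the one-sided limits with signs $+$ and $-$ are taken from the warmer phase (phase $i$) and from the colder phase (phase $i-1$), respectively; and $u(0,x)=u_0$ for all $x>0$, $\alpha(u)_x(t,0)=t^{-1/2}b_N$ for all $t>0$. Self-similar solution of type $n$, $0\le n\le m$: a solution $u=u(\xi)$, $\xi=x/\sqrt t$, with $u_n<u(0)\le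 u_{n+1}$, which for some numbers $+\infty=\xi_0>\xi_1>\cdots>\xi_n>0$ has the form $$u(\xi)=u_i+\frac{u_{i+1}-u_i}{F(\xi_{i+1}/a_i)-F(\xi_i/a_i)}\bigl(F(\xi/a_i)-F(\xi_i/a_i)\bigr),\quad \xi_{i+1}<\xi<\xi_i,\ i=0,\ldots,n-1,$$ $$u(\xi)=u_n+\frac{a_n}{k_n}b_N\sqrt{\pi}\,\bigl(F(\xi/a_n)-F(\xi_n/a_n)\bigr),\quad 0<\xi<\xi_n,$$ with $u(\xi_i)=u_i$, $1\le i\le n$ (for $n=0$ only the second formula is present, with $\xi_0=+\infty$, i.e. $u(\xi)=u_0+\frac{a_0}{k_0}b_N\sqrt\pi(F(\xi/a_0)-1)$). The phase transition lines are $x=\xi_i\sqrt t$, $i=1,\ldots,n$; the initial and boundary conditions read $u(+\infty)=u_0$, $k_nu'(0)=b_N$. If $u_0=u_1$ and $n\ge1$, then $u\equiv u_0$ for $\xi>\xi_1$ and the derivative from the colder side at $\xi_1$ is $0$. Numbers $\gamma_n$: $\gamma_0=0$, $\gamma_{m+1}=+\infty$, and for $1\le n\le m$ $$\gamma_n=\frac{k_{n-1}(u_n-u_{n-1})}{\sqrt{\pi}\,a_{n-1}F(\xi^n_{n-1}/a_{n-1})},$$ where $\xi^1_0=+\infty$ (so $\gamma_1=k_0(u_1-u_0)/(a_0\sqrt\pi)$) and, for $n\ge 2$, $(\xi^n_1,\ldots,\xi^n_{n-1})$ is the unique minimum point over $\{(\xi_1,\ldots,\xi_{n-1})\in\mathbb{R}^{n-1}:\xi_1>\cdots>\xi_{n-1}>0\}$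 of the function $$-\sum_{i=0}^{n-1}k_i(u_{i+1}-u_i)\ln\bigl(F(\xi_i/a_i)-F(\xi_{i+1}/a_i)\bigr)+\frac14\sum_{i=1}^{n-1}d_i\xi_i^2,\qquad \xi_0=+\infty,\ \xi_n=0$$ (this is a strictly convex function that attains its minimum; equivalently $\xi^n_i$ are the phase transition parameters of the unique self-similar solution of the corresponding Stefan–Dirichlet problem with boundary value $u(t,0)=u_n$). *)

(* Defs.v *)
From HB Require Import structures.
From mathcomp Require Export all_boot all_order all_algebra.
From mathcomp Require Export all_classical all_reals all_analysis.
Export Order.TTheory GRing.Theory Num.Theory.
Export numFieldNormedType.Exports.
Set Implicit Arguments.
Unset Strict Implicit.
Unset Printing Implicit Defensive.
Local Open Scope classical_set_scope.
Local Open Scope ring_scope.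

(* Only used for z >= 0 (the integral below is 0 for z < 0). *)
Definition F {R : realType} (z : R) : R :=
  (Num.sqrt pi)^-1 *
  \int[@lebesgue_measure R]_(s in `[0, z]) expR (- (s ^+ 2 / 4)).

(* [Fdiv c z] is F(z / c), with the convention F(+oo) = 1. *)
Definition Fdiv {R : realType} (c : R) (z : \bar R) : R :=
  match z with
  | r%:E => F (r / c)
  | +oo%E => 1
  | -oo%E => 0
  end.

(* The N-tuple (xi_1, ..., xi_N) is extended by xi_0 = +oo and xi_i = 0 for
   i > N. *)
Definition xi_ext {R : realType} (N : nat) (xi : N.-tuple R) (i : nat)
    : \bar R :=
  nth 0%E (+oo%E :: [seq x%:E | x <- xi]) i.

(* +oo > xi_1 > ... > xi_N > 0 *)
Definition xi_decreasing {R : realType} (N : nat) (xi : N.-tuple R) : Prop :=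
  forall i, (i <= N)%N -> (xi_ext xi i.+1 < xi_ext xi i)%E.

Section StefanNeumann.
Variables (R : realType) (m : nat) (u_ a k d : nat -> R).

(* u_0, ..., u_m, u_{m+1} = +oo *)
Definition temp (i : nat) : \bar R :=
  if (i <= m)%N then (u_ i)%:E else +oo%E.

Definition phase_domain (i : nat) (v : R) : Prop :=
  (temp i < v%:E)%E /\ (v%:E < temp i.+1)%E.

(* When u_0 = u_1 the cold phase 0 has no open temperature range: it is the
   part of the medium kept at the temperature u_0. *)
Definition in_phase (i : nat) (v : R) : Prop :=
  phase_domain i v \/ [/\ i = 0%N, u_ 0 = u_ 1 & v = u_ 0].

Definition is_alpha (alpha : R -> R) : Prop :=
  {within `[u_ 0, +oo[, continuous alpha} /\
  (forall i (v w : R), (i <= m)%N -> phase_domain i v -> phase_domain i w ->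
     alpha v - alpha w = k i * (v - w)).

Definition side (left : bool) (x : R) : set_system R :=
  if left then x^'- else x^'+.

(* The curve x = X t, for t in ]t1, t2[, is a line of transition between the
   phases i and i.-1; the warmer phase i lies on its left (smaller x) if
   [warm_left], and on its right otherwise. *)
Definition phase_transition_line (u : R -> R -> R) (i : nat)
    (warm_left : bool) (t1 t2 : R) (X : R -> R) : Prop :=
  0 <= t1 /\
  forall t : R, t1 < t < t2 ->
    [/\ 0 < X t, {for t, continuous X}, u t (X t) = u_ i,
        \forall x \near side warm_left (X t), in_phase i (u t x) &
        \forall x \near side (~~ warm_left) (X t), in_phase i.-1 (u t x)].

Definition stefan_condition (u : R -> R -> R) (i : nat) (warm_left : bool)
    (X : R -> R) (t : R) : Prop :=
  derivable X t 1 /\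
  exists ux_warm ux_cold : R,
    [/\ derive1 (u t) x @[x --> side warm_left (X t)] --> ux_warm,
        derive1 (u t) x @[x --> side (~~ warm_left) (X t)] --> ux_cold &
        d i * derive1 X t + k i * ux_warm - k i.-1 * ux_cold = 0].

Definition heat_equation (u : R -> R -> R) (c t x : R) : Prop :=
  [/\ derivable (u ^~ x) t 1, derivable (u t) x 1,
      derivable (derive1 (u t)) x 1 &
      derive1 (u ^~ x) t = c ^+ 2 * derive1n 2 (u t) x].

Definition smooth_at (u : R -> R -> R) (t x : R) : Prop :=
  [/\ {for (t, x), continuous (fun p : R * R => derive1 (u ^~ p.2) p.1)},
      {for (t, x), continuous (fun p : R * R => derive1 (u p.1) p.2)} &
      {for (t, x), continuous (fun p : R * R => derive1n 2 (u p.1) p.2)}].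

(* The values of u outside of {t > 0, x > 0} are irrelevant; the initial and
   the boundary values are limits from this domain. *)
Record stefan_neumann_solution (alpha : R -> R) (bN : R) (u : R -> R -> R)
    : Prop := {
  sn_range : forall t x : R, 0 < t -> 0 < x -> u_ 0 <= u t x ;
  sn_continuous : forall t x : R, 0 < t -> 0 < x ->
    {for (t, x), continuous (fun p : R * R => u p.1 p.2)} ;
  (* piecewise smoothness: the phases fill the quadrant up to a nowhere dense
     set, and u is smooth in each of the domains u_i < u < u_{i+1} *)
  sn_dense : forall t x : R, 0 < t -> 0 < x ->
    closure [set p : R * R | [/\ 0 < p.1, 0 < p.2 &
      exists2 i, (i <= m)%N & in_phase i (u p.1 p.2)]] (t, x) ;
  sn_heat : forall i (t x : R), (i <= m)%N -> 0 < t -> 0 < x ->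
    phase_domain i (u t x) -> heat_equation u (a i) t x /\ smooth_at u t x ;
  sn_stefan : forall i warm_left (t1 t2 : R) X, (1 <= i <= m)%N ->
    phase_transition_line u i warm_left t1 t2 X ->
    forall t : R, t1 < t < t2 -> stefan_condition u i warm_left X t ;
  sn_initial : forall x : R, 0 < x ->
    u p.1 p.2 @[p --> within [set p : R * R | 0 < p.1] (nbhs ((0, x) : R * R))]
      --> u_ 0 ;
  sn_boundary : forall t : R, 0 < t ->
    (\forall x \near 0^'+, derivable (alpha \o u t) x 1) /\
    derive1 (alpha \o u t) x @[x --> 0^'+] --> bN / Num.sqrt t }.

Record profile_form (bN : R) (n : nat) (xi : n.-tuple R) (U : R -> R)
    : Prop := {
  pf_decreasing : xi_decreasing xi ;
  pf_inner : forall i (z : R), (i < n)%N ->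
    (xi_ext xi i.+1 < z%:E)%E -> (z%:E < xi_ext xi i)%E ->
    U z = u_ i + (u_ i.+1 - u_ i) /
                 (Fdiv (a i) (xi_ext xi i.+1) - Fdiv (a i) (xi_ext xi i)) *
                 (Fdiv (a i) z%:E - Fdiv (a i) (xi_ext xi i)) ;
  pf_last : forall z : R, 0 < z -> (z%:E < xi_ext xi n)%E ->
    U z = u_ n + a n / k n * bN * Num.sqrt pi *
                 (Fdiv (a n) z%:E - Fdiv (a n) (xi_ext xi n)) ;
  pf_lines : forall i (z : R), (1 <= i <= n)%N -> xi_ext xi i = z%:E ->
    U z = u_ i }.

Definition self_similar_solution (alpha : R -> R) (bN : R) (n : nat)
    (u : R -> R -> R) : Prop :=
  [/\ (n <= m)%N,
      stefan_neumann_solution alpha bN u &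
      exists (U : R -> R) (U0 : R) (xi : n.-tuple R),
        [/\ forall t x : R, 0 < t -> 0 < x -> u t x = U (x / Num.sqrt t),
            U z @[z --> 0^'+] --> U0,
            (temp n < U0%:E)%E /\ (U0%:E <= temp n.+1)%E &
            profile_form bN xi U]].

(* Here xi = (xi_1, ..., xi_{n-1}), n >= 1; [xi_ext] gives xi_0 = +oo and
   xi_n = 0. *)
Definition dirichlet_energy (n : nat) (xi : n.-1.-tuple R) : R :=
  - (\sum_(0 <= i < n) k i * (u_ i.+1 - u_ i) *
       ln (Fdiv (a i) (xi_ext xi i) - Fdiv (a i) (xi_ext xi i.+1)))
  + 4^-1 * \sum_(1 <= i < n) d i * fine (xi_ext xi i) ^+ 2.

Definition is_min_point (n : nat) (xi : n.-1.-tuple R) : Prop :=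
  xi_decreasing xi /\
  forall eta : n.-1.-tuple R, xi_decreasing eta ->
    dirichlet_energy xi <= dirichlet_energy eta.

Definition min_point (n : nat) : n.-1.-tuple R :=
  xget [tuple of nseq n.-1 0] [set xi | is_min_point xi].

Definition gamma (n : nat) : \bar R :=
  if n == 0%N then 0%E
  else if (n <= m)%N then
    (k n.-1 * (u_ n - u_ n.-1) /
     (Num.sqrt pi * a n.-1 *
      Fdiv (a n.-1) (xi_ext (min_point n) n.-1)))%:E
  else +oo%E.

End StefanNeumann.

(* Main.v *)
Require Import Defs.
From HB Require Import structures.
From mathcomp Require Import ring lra zify.
(** A self-similar solution of type n is determined by the positions
    x_1 > ... > x_n > 0 of its lines x = x_i sqrt t. Put w_i = k_i (u_{i+1} - u_i),
    Phi_i z = F (z / a_i), phi_i = Phi_i', x_0 = +oo, Phi_0 x_0 = 1 and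
    gap_i = Phi_i x_i - Phi_i x_{i+1}. Inside a phase the function is affine in
    Phi_i (x / sqrt t), which solves the heat equation, so that all the content of
    the problem lies in the Stefan conditions
<<
      d_i x_i / 2 + w_{i-1} phi_{i-1}(x_i) / gap_{i-1} = w_i phi_i(x_i) / gap_i
      d_n x_n / 2 + w_{n-1} phi_{n-1}(x_n) / gap_{n-1}
                                            = - b_N exp (- x_n^2 / (4 a_n^2))
>>
    the first one for 1 <= i < n, and in the inequality u(0) <= u_{n+1}. The lemmas
    [balance_of_solution] and [solution_of_balance] translate between the partial
    differential equation and these conditions.

    The system is solved by shooting, with the last position y = x_n >= 0 as
    parameter. For every y exactly one list of lines ending at y satisfies the
    conditions on the lines before the last ([chain_system], [system_unique]), and
    the left-hand side of the last condition, as a function of y, is continuous and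
    strictly increasing ([flux_regularity]). The induction step is an elementary
    comparison ([step_compare]) that rests on the log-concavity of the Gaussian:
    when a line moves outwards, the preceding line moves outwards too, and the phase
    between the two gets thinner and transmits more heat.

    The last condition therefore equates an increasing and a decreasing function of
    y. It has a root y > 0, which is then unique, if and only if - b_N exceeds the
    value at y = 0 of the flux through n lines ([neumann_root_exists],
    [neumann_root_flux]); and u(0) <= u_{n+1} holds if and only if - b_N is at most
    the value at 0 of the flux through n + 1 lines ([neumann_top]). These values at 0
    do not decrease with n ([flux_at0_le]), so exactly one type n occurs.

    It remains to see that they are the numbers gamma_n, which are defined from the
    minimum point of an energy. The function ln (Phi x - Phi y) is strictly concave
    ([log_gap_tangent]). Adding up its tangent inequalities at a solution of the
    Stefan conditions, the linear terms cancel, so that the chain ending at 0 is the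
    strict minimum ([energy_lt], [min_point_chain], [gammaE]). *)

Set Implicit Arguments.
Unset Strict Implicit.
Unset Printing Implicit Defensive.
Local Open Scope classical_set_scope.
Local Open Scope ring_scope.

(** * Calculus of derivatives *)

Section DerivationRules.
Context {R : realType}.
Implicit Types (f g : R -> R) (x y a b c d : R).

Lemma der_eq f x d d' : is_derive x 1 f d -> d = d' -> is_derive x 1 f d'.
Proof. by move=> ? <-. Qed.

Lemma der_cst c x : is_derive x 1 (fun=> c) 0.
Proof. exact: is_derive_cst. Qed.

Lemma der_id x : is_derive x 1 (fun z : R => z) 1.
Proof. exact: is_derive_id. Qed.

Lemma derD f g x a b : is_derive x 1 f a -> is_derive x 1 g b ->
  is_derive x 1 (fun z => f z + g z) (a + b).
Proof. by move=> ? ?; apply: is_deriveD. Qed.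

Lemma derN f x a : is_derive x 1 f a -> is_derive x 1 (fun z => - f z) (- a).
Proof. by move=> ?; apply: is_deriveN. Qed.

Lemma derB f g x a b : is_derive x 1 f a -> is_derive x 1 g b ->
  is_derive x 1 (fun z => f z - g z) (a - b).
Proof. by move=> ? ?; apply: is_deriveB. Qed.

Lemma derM f g x a b : is_derive x 1 f a -> is_derive x 1 g b ->
  is_derive x 1 (fun z => f z * g z) (a * g x + f x * b).
Proof.
move=> df dg; apply: (der_eq (is_deriveM df dg)).
by rewrite addrC; congr (_ + _); exact: mulrC.
Qed.

Lemma derZ c f x a : is_derive x 1 f a ->
  is_derive x 1 (fun z => c * f z) (c * a).
Proof.
by move=> df; apply: (der_eq (derM (der_cst c x) df)); rewrite mul0r add0r.
Qed.

Lemma der_comp f g x a b : is_derive (g x) 1 f a -> is_derive x 1 g b ->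
  is_derive x 1 (fun z => f (g z)) (a * b).
Proof. by move=> df dg; exact: is_derive1_comp. Qed.

Lemma derV f x a : f x != 0 -> is_derive x 1 f a ->
  is_derive x 1 (fun z => (f z)^-1) (- a / f x ^+ 2).
Proof.
move=> f0 df; apply: (der_eq (is_deriveV f0 df)).
by rewrite -[LHS]/(- (f x ^+ 2)^-1 * a) mulNr mulrC mulNr.
Qed.

Lemma der_cont f x a : is_derive x 1 f a -> {for x, continuous f}.
Proof.
by case=> df _; apply: differentiable_continuous; exact/derivable1_diffP.
Qed.

Lemma der_MVT f df x y : x < y -> (forall z, x <= z <= y -> is_derive z 1 f (df z)) ->
  exists2 c, x < c < y & f y - f x = df c * (y - x).
Proof.
move=> xy d; have [||c cxy e] := @MVT R f df x y xy.
- by move=> z; rewrite in_itv/= => /andP[xz zy]; apply: d; rewrite !ltW.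
- apply: derivable_within_continuous => z; rewrite in_itv/= => zxy.
  by have [] := d z zxy.
- by exists c => //; rewrite in_itv/= in cxy.
Qed.

Lemma der_incr f df x y : x < y ->
  (forall z, x <= z <= y -> is_derive z 1 f (df z)) ->
  (forall z, x < z < y -> 0 < df z) -> f x < f y.
Proof.
move=> xy d p; have [c cxy e] := der_MVT xy d.
by rewrite -subr_gt0 e mulr_gt0 ?p// subr_gt0.
Qed.

End DerivationRules.

(** * The function F as a primitive of a Gaussian on the whole line *)

Section GaussPrimitive.
Context {R : realType}.
Implicit Types x y z : R.

(** Integrating from -oo gives a primitive that is differentiable at every real
    number, in particular at 0, where F has only a right derivative. *)
Definition gauss_prim x : R :=
  \int[@lebesgue_measure R]_(s in `]-oo, x]) gauss_fun s.

Lemma integrable_gauss (A : set R) : measurable A ->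
  (@lebesgue_measure R).-integrable A (EFin \o gauss_fun).
Proof.
move=> mA; apply: (@integrableS _ _ _ _ setT) => //; exact: integrableT_gauss.
Qed.

Lemma is_derive_gauss_prim x : is_derive x 1 gauss_prim (gauss_fun x).
Proof.
have [d e] : derivable gauss_prim x 1 /\ derive1 gauss_prim x = gauss_fun x.
  apply: (@continuous_FTC1 R gauss_fun -oo%O x (x + 1)) => //.
  - lra.
  - exact: integrable_gauss.
  - by rewrite ltNyr.
  - exact: continuous_gauss_fun.
by rewrite -e derive1E; exact: derivableP.
Qed.

Lemma gauss_primB x : 0 <= x ->
  gauss_prim x - gauss_prim 0 = gauss_integral_proof.integral0_gauss x.
Proof.
move=> x0; rewrite /gauss_prim /gauss_integral_proof.integral0_gauss.
rewrite Rintegral_itvB ?bnd_simp//; last exact: integrable_gauss.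
by rewrite Rintegral_itv_obnd_cbnd//; exact: integrable_gauss.
Qed.

(** The value of the Gauss integral, from the limit of the square of the truncated
    integral. *)
Lemma gauss_prim_cvg :
  gauss_prim x - gauss_prim 0 @[x --> +oo] --> Num.sqrt pi / 2.
Proof.
have : Num.sqrt (@gauss_integral_proof.integral0_gauss R x ^+ 2)
    @[x --> +oo] --> Num.sqrt (pi / 4).
  apply: continuous_cvg => //; first exact: sqrt_continuous.
  exact: gauss_integral_proof.cvg_integral0_gauss_sqr.
have -> : Num.sqrt (pi / 4) = Num.sqrt pi / 2 :> R.
  rewrite sqrtrM ?pi_ge0// sqrtrV// (_ : 4 = 2 ^+ 2); last by lra.
  by rewrite sqrtr_sqr ger0_norm.
apply: cvg_trans; apply: near_eq_cvg; near=> x.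
rewrite gauss_primB; last by near: x; exact: nbhs_pinfty_ge.
rewrite sqrtr_sqr ger0_norm//; exact: gauss_integral_proof.integral0_gauss_ge0.
Unshelve. all: by end_near. Qed.

Definition F_density x : R := (Num.sqrt pi)^-1 * expR (- (x ^+ 2 / 4)).

(** The extension of F to a smooth increasing function on the line; the factors 2
    come from the substitution s = 2 r, which turns exp (- s^2 / 4) into
    exp (- r^2). *)
Definition F_ext x : R := (Num.sqrt pi)^-1 * (2 * (gauss_prim (x / 2) - gauss_prim 0)).

Lemma sqrtpi_gt0 : 0 < Num.sqrt pi :> R.
Proof. by rewrite sqrtr_gt0 pi_gt0. Qed.

Lemma F_density_gt0 x : 0 < F_density x.
Proof. by rewrite mulr_gt0 ?invr_gt0 ?sqrtpi_gt0 ?expR_gt0. Qed.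

Lemma is_derive_half_gauss_prim x :
  is_derive x 1 (fun z => 2 * gauss_prim (z / 2)) (expR (- (x ^+ 2 / 4))).
Proof.
have h := derM (der_id x) (der_cst (2^-1 : R) x).
apply: (der_eq (derZ 2 (der_comp (is_derive_gauss_prim _) h))).
rewrite /gauss_fun mulr0 addr0 mul1r mulrCA divff ?mulr1//.
by congr expR; field.
Qed.

Lemma is_derive_F_ext x : is_derive x 1 F_ext (F_density x).
Proof.
have h := is_derive_half_gauss_prim x.
have -> : F_ext = fun z => (Num.sqrt pi)^-1 * (2 * gauss_prim (z / 2) - 2 * gauss_prim 0).
  by apply/funext => z; rewrite /F_ext mulrBr.
by apply: (der_eq (derZ _ (derB h (der_cst _ x)))); rewrite subr0.
Qed.

Lemma F_ext0 : F_ext 0 = 0.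
Proof. by rewrite /F_ext mul0r subrr !mulr0. Qed.

Lemma F_extE x : 0 <= x -> F x = F_ext x.
Proof.
rewrite le_eqVlt => /predU1P[<-|x0].
  by rewrite F_ext0 /F set_itv1 Rintegral_set1 mulr0.
rewrite /F /F_ext /Rintegral; congr (_ * _).
have c (z : R) : {for z, continuous (fun z => 2 * gauss_prim (z / 2))}.
  apply: differentiable_continuous; apply/derivable1_diffP.
  by have [] := is_derive_half_gauss_prim z.
rewrite (@continuous_FTC2 R _ (fun z => 2 * gauss_prim (z / 2)))//.
- by rewrite /= mul0r mulrBr.
- apply: continuous_subspaceT => z.
  apply: (@continuous_comp _ _ _ (fun x : R => - (x ^+ 2 / 4)) expR).
    by apply: cvgN; apply: cvgMl; exact: exprn_continuous.
  exact: continuous_expR.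
- split.
  + by move=> z _; have [] := is_derive_half_gauss_prim z.
  + exact/cvg_at_right_filter/c.
  + exact/cvg_at_left_filter/c.
- by move=> z _; rewrite derive1E; have [_ ->] := is_derive_half_gauss_prim z.
Qed.

Lemma F_ext_lt x y : x < y -> F_ext x < F_ext y.
Proof.
move=> xy.
have [||c _ e] := @MVT R F_ext F_density x y xy.
- by move=> z _; exact: is_derive_F_ext.
- by apply: derivable_within_continuous => z _; have [] := is_derive_F_ext z.
by rewrite -subr_gt0 e mulr_gt0 ?F_density_gt0// subr_gt0.
Qed.

Lemma F_ext_cvg : F_ext x @[x --> +oo] --> (1 : R).
Proof.
have h : (fun x : R => x / 2) @ +oo%R --> +oo%R.
  apply/cvgryPge => A; near=> x.
  by rewrite ler_pdivlMr//; near: x; exact: nbhs_pinfty_ge.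
have := cvg_comp _ _ h gauss_prim_cvg => {}h.
have -> : 1 = (Num.sqrt pi)^-1 * (2 * (Num.sqrt pi / 2)) :> R.
  by field; rewrite gt_eqF ?sqrtpi_gt0.
by apply: cvgMr; exact: cvgMr h.
Unshelve. all: by end_near. Qed.

Lemma F_ext_lt1 x : F_ext x < 1.
Proof.
apply: (@lt_le_trans _ _ (F_ext (x + 1))); first by apply: F_ext_lt; lra.
apply: (cvgr_to_ge F_ext_cvg); near=> y; apply/ltW/F_ext_lt.
by near: y; exact: nbhs_pinfty_gt (num_real _).
Unshelve. all: by end_near. Qed.

End GaussPrimitive.

(** * Gaussian mass inside one phase *)

(** The similarity profile of the heat equation u_t = c^2 u_xx, up to an affine
    map, and its derivative. They are locked so that rewriting with ring laws does not
    unfold the products inside them. *)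
HB.lock Definition Phi {R : realType} (c z : R) : R := F_ext (z / c).
HB.lock Definition phi {R : realType} (c z : R) : R := F_density (z / c) / c.

Section OnePhase.
Context {R : realType}.
Implicit Types c x y z l w g h : R.

Lemma phi_gt0 c z : 0 < c -> 0 < phi c z.
Proof. by move=> c0; rewrite phi.unlock divr_gt0// F_density_gt0. Qed.

Lemma phiE c z : phi c z = expR (- ((z / c) ^+ 2 / 4)) / (Num.sqrt pi * c).
Proof. by rewrite phi.unlock /F_density invfM mulrCA !mulrA. Qed.

Lemma der_divr c x : is_derive x 1 (fun z => z / c) c^-1.
Proof.
by apply: (der_eq (derM (der_id x) (der_cst c^-1 x))); rewrite mul1r mulr0 addr0.
Qed.

Lemma der_Phi c z : is_derive z 1 (Phi c) (phi c z).
Proof.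
rewrite Phi.unlock phi.unlock; exact: (der_comp (is_derive_F_ext _) (der_divr c z)).
Qed.

Lemma der_phi c z : is_derive z 1 (phi c) (- (z / (2 * c ^+ 2)) * phi c z).
Proof.
rewrite (_ : phi c = fun z => (Num.sqrt pi * c)^-1 * expR (- (z / c * (z / c) * 4^-1))).
  have h := der_divr c z.
  have h2 := derN (derM (derM h h) (der_cst (4^-1 : R) z)).
  apply: (der_eq (derZ (Num.sqrt pi * c)^-1 (der_comp (is_derive_expR _) h2))).
  set e := expR _; rewrite (_ : z / (2 * c ^+ 2) = 2^-1 * (z / c * c^-1)); last first.
    by rewrite invfM -exprVn expr2; ring.
  by set p := (_ * c)^-1; set i := c^-1; field.
by apply/funext => t; rewrite phiE expr2 mulrC.
Qed.

Lemma Phi_lt c x y : 0 < c -> x < y -> Phi c x < Phi c y.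
Proof. by move=> c0 xy; rewrite Phi.unlock; apply: F_ext_lt; rewrite ltr_pM2r ?invr_gt0. Qed.

Lemma Phi_le c x y : 0 < c -> x <= y -> Phi c x <= Phi c y.
Proof. by move=> c0; rewrite le_eqVlt => /predU1P[->//|/(Phi_lt c0)/ltW]. Qed.

Lemma Phi_lt1 c x : Phi c x < 1. Proof. by rewrite Phi.unlock F_ext_lt1. Qed.

Lemma Phi0 c : Phi c 0 = 0. Proof. by rewrite Phi.unlock mul0r F_ext0. Qed.

Lemma cvg_divr_pinfty c : 0 < c -> (fun x : R => x / c) @ +oo --> +oo.
Proof.
move=> c0; apply/cvgryPge => A; near=> x.
by rewrite ler_pdivlMr//; near: x; exact: nbhs_pinfty_ge.
Unshelve. all: by end_near. Qed.

Lemma Phi_cvg c : 0 < c -> Phi c @ +oo --> (1 : R).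
Proof. by rewrite Phi.unlock => c0; exact: (cvg_comp _ _ (cvg_divr_pinfty c0) F_ext_cvg). Qed.

Lemma phi_cvg c : 0 < c -> phi c @ +oo --> (0 : R).
Proof.
move=> c0.
have -> : phi c = fun z => (Num.sqrt pi * c)^-1 * gauss_fun (z / (c * 2)).
  apply/funext => z; rewrite phiE mulrC /gauss_fun.
  by congr (_ * expR _); field; rewrite gt_eqF.
rewrite -(mulr0 (Num.sqrt pi * c)^-1).
apply: cvgMr; apply: (cvg_comp _ _ (@cvg_divr_pinfty (c * 2) _) cvg_gauss_fun).
by rewrite mulr_gt0.
Qed.

Lemma phi_lt c x y : 0 < c -> 0 <= x -> x < y -> phi c y < phi c x.
Proof.
move=> c0 x0 xy; rewrite !phiE ltr_pM2r ?invr_gt0 ?mulr_gt0 ?sqrtpi_gt0//.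
rewrite ltr_expR ltrN2 ltr_pM2r// ltrXn2r//; last by rewrite ltr_pM2r ?invr_gt0.
by rewrite divr_ge0// ltW.
Qed.

(** The exponents differ by (y - x) l / (2 c^2): the ratio
    phi (x + l) / phi x decreases in x. All the comparisons of fluxes below
    rest on this log-concavity. *)
Lemma phi_logconcave c x y l : 0 < c -> 0 < l -> x < y ->
  phi c (y + l) * phi c x < phi c (x + l) * phi c y.
Proof.
move=> c0 l0 xy; rewrite !phiE !mulf_div -!expRD.
rewrite ltr_pM2r ?invr_gt0 ?mulr_gt0 ?sqrtpi_gt0// ltr_expR -subr_gt0.
have -> : - (((x + l) / c) ^+ 2 / 4) + - ((y / c) ^+ 2 / 4) -
  (- (((y + l) / c) ^+ 2 / 4) + - ((x / c) ^+ 2 / 4)) =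
  (y - x) * l * c^-1 ^+ 2 / 2 by field; rewrite gt_eqF.
by rewrite !mulr_gt0 ?exprn_gt0 ?invr_gt0 ?subr_gt0.
Qed.

Lemma der_shiftl c y l : is_derive l 1 (fun l => Phi c (y + l)) (phi c (y + l)).
Proof.
by apply: (der_eq (der_comp (der_Phi _ _) (derD (der_cst y l) (der_id l))));
  rewrite add0r mulr1.
Qed.

(** In l both sides are the same function, whose derivative is positive by
    [phi_logconcave]. Comparing derivatives in the length l avoids any change of
    variables in the integral F. *)
Lemma mass_ahead_lt c x y l l' : 0 < c -> x < y -> 0 <= l -> l < l' ->
  (Phi c (x + l) - Phi c x) * phi c y - (Phi c (y + l) - Phi c y) * phi c x <
  (Phi c (x + l') - Phi c x) * phi c y - (Phi c (y + l') - Phi c y) * phi c x.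
Proof.
move=> c0 xy l0 ll'; apply: (der_incr (f := fun l =>
   (Phi c (x + l) - Phi c x) * phi c y - (Phi c (y + l) - Phi c y) * phi c x)
  (df := fun l => phi c (x + l) * phi c y - phi c (y + l) * phi c x) ll').
- move=> z _; have h t u := derM (derB (der_shiftl c t z) (der_cst (Phi c t) z))
    (der_cst (phi c u) z).
  by apply: (der_eq (derB (h x y) (h y x))); rewrite !mulr0 !addr0 !subr0.
- move=> z /andP[lz _]; rewrite subr_gt0 phi_logconcave//.
  exact: le_lt_trans lz.
Qed.

(** The mass of a layer of length l, relative to the density at its warm end,
    decreases when the layer moves away from the origin. *)
Lemma mass_ahead c x y l : 0 < c -> x < y -> 0 < l ->
  (Phi c (y + l) - Phi c y) * phi c x < (Phi c (x + l) - Phi c x) * phi c y.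
Proof.
move=> c0 xy l0; have := mass_ahead_lt c0 xy (lexx 0) l0.
by rewrite !addr0 !subrr !mul0r subrr subr_gt0.
Qed.

(** The limit l -> +oo of [mass_ahead]; it stays strict because
    [mass_ahead_lt] gives a positive lower bound, the value at l = 1. *)
Lemma mass_tail c x y : 0 < c -> x < y ->
  (1 - Phi c y) * phi c x < (1 - Phi c x) * phi c y.
Proof.
move=> c0 xy; have h1 := mass_ahead_lt c0 xy (lexx 0) ltr01.
rewrite !addr0 !subrr !mul0r subrr in h1.
rewrite -subr_gt0; apply: (lt_le_trans h1).
have sh (t : R) : (fun l => Phi c (t + l)) @ +oo --> (1 : R).
  apply: (cvg_comp _ _ _ (Phi_cvg c0)).
  apply/cvgryPge => A; near=> l.
  by rewrite -lerBlDl; near: l; exact: nbhs_pinfty_ge (num_real _).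
apply: (@cvgr_to_ge _ (+oo%R : set_system R) _ _ (fun l =>
  (Phi c (x + l) - Phi c x) * phi c y - (Phi c (y + l) - Phi c y) * phi c x)).
  by apply: cvgB; apply: cvgMl; apply: cvgB; [exact: sh|exact: cvg_cst|
    exact: sh|exact: cvg_cst].
near=> l.
apply/ltW/mass_ahead_lt => //; near: l; exact: nbhs_pinfty_gt (num_real _).
Unshelve. all: by end_near. Qed.

(** Measured relative to the density at the cold end, the mass of a layer of
    given length increases instead. *)
Lemma mass_behind c x y l : 0 < c -> x < y -> 0 < l ->
  (Phi c x - Phi c (x - l)) * phi c y < (Phi c y - Phi c (y - l)) * phi c x.
Proof.
move=> c0 xy l0; rewrite -subr_gt0.
pose f l := (Phi c y - Phi c (y - l)) * phi c x - (Phi c x - Phi c (x - l)) * phi c y.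
rewrite -[ltRHS]/(f l) (_ : 0 = f 0); last first.
  by rewrite /f !subr0 !subrr !mul0r subrr.
apply: (der_incr (df := fun l => phi c (y - l) * phi c x - phi c (x - l) * phi c y)).
- by [].
- move=> z _; have h t u := derM (derB (der_cst (Phi c t) z)
    (der_comp (der_Phi c _) (derB (der_cst t z) (der_id z)))) (der_cst (phi c u) z).
  apply: (der_eq (derB (h y x) (h x y))).
  by rewrite !mulr0 !addr0 !sub0r !mulrN1 !opprK.
- move=> z /andP[z0 _]; rewrite subr_gt0.
  have := @phi_logconcave c (x - z) (y - z) z c0 z0.
  by rewrite !subrK ltrD2r => /(_ xy); rewrite mulrC [ltRHS]mulrC.
Qed.

(** The comparison that drives the shooting. A phase occupies [y, x] and receives
    the flux g at its cold end x, which fixes y; here w phi y / (Phi x - Phi y)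
    is the flux that leaves at y. If x moves outwards and g does not decrease,
    then by [mass_behind] the layer gets shorter; being shorter and farther out it
    lets, by [mass_ahead], a larger flux leave. *)
Lemma step_compare c w g h x x' y y' : 0 < c -> 0 < w -> 0 < g -> g <= h ->
  x < x' -> y < x -> y' < x' ->
  (Phi c x - Phi c y) * g = w * phi c x ->
  (Phi c x' - Phi c y') * h = w * phi c x' ->
  (Phi c x' - Phi c y') * phi c y < (Phi c x - Phi c y) * phi c y'.
Proof.
move=> c0 w0 g0 gh xx' yx y'x' e e'.
(* The layer [y', x'] is shorter: otherwise it contains the translate of [y, x]
   that ends at x', whose mass is already too large for the flux h >= g. *)
have lt : x' - y' < x - y.
  rewrite ltNge; apply/negP => le.
  have h0 : 0 < h := lt_le_trans g0 gh.
  have := @mass_behind c x x' (x - y) c0 xx'.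
  rewrite subKr subr_gt0 => /(_ yx); apply/negP; rewrite -leNgt.
  rewrite -(ler_pM2r (mulr_gt0 w0 h0)).
  have -> : (Phi c x - Phi c y) * phi c x' * (w * h) =
    (Phi c x - Phi c y) * h * ((Phi c x' - Phi c y') * h) by rewrite e'; ring.
  have -> : (Phi c x' - Phi c (x' - (x - y))) * phi c x * (w * h) =
    (Phi c x - Phi c y) * h * ((Phi c x' - Phi c (x' - (x - y))) * g).
    transitivity (h * (Phi c x' - Phi c (x' - (x - y))) * (w * phi c x)); first ring.
    by rewrite -e; ring.
  rewrite ler_pM2l ?mulr_gt0 ?subr_gt0 ?Phi_lt//.
  apply: ler_pM => //; first by rewrite subr_ge0 Phi_le//; lra.
    exact: ltW.
  by rewrite lerD2l lerN2 Phi_le//; lra.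
have yy' : y < y' by lra.
have := @mass_ahead c y y' (x - y) c0 yy'.
rewrite subr_gt0 => /(_ yx); rewrite [y + _]addrC subrK; apply: lt_trans.
rewrite ltr_pM2r ?phi_gt0// ltrD2r Phi_lt//; lra.
Qed.

End OnePhase.

(** * The line preceding a given line *)

Section Crossing.
Context {R : realType}.
Variables (c : R) (g : R -> R).
Hypothesis c0 : 0 < c.
Hypothesis g_cont : {within `[0, +oo[, continuous g}.
Hypothesis g_incr : forall x y : R, 0 <= x -> x < y -> g x < g y.
Hypothesis g_ge0 : 0 <= g 0.
Implicit Types (x y w b : R) (p : R -> R).

Lemma flux_gt0 x : 0 < x -> 0 < g x.
Proof. by move=> x0; exact: le_lt_trans (g_incr _ x0). Qed.

(** At y the Gaussian side is larger; far out it tends to 0, while p g stays above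
    its positive value at y + 1. The factor p is either Phi - Phi y (next phase)
    or 1 (Neumann condition). *)
Lemma crossing_exists p b y : 0 <= y -> (forall x, {for x, continuous p}) ->
  (forall x z, x <= z -> p x <= p z) -> 0 < p (y + 1) ->
  p y * g y < b * phi c y ->
  exists2 x, y < x & p x * g x = b * phi c x.
Proof.
move=> y0 pc p_mono p1 fy.
have y10 : 0 < y + 1 by lra.
have d0 : 0 < p (y + 1) * g (y + 1) by rewrite mulr_gt0 ?flux_gt0.
have : b * phi c x @[x --> +oo] --> b * 0 by apply: cvgMr; exact: phi_cvg.
rewrite mulr0 => /cvgr_lt /(_ _ d0) near_small.
have [M [yM bM]] : exists M : R, y + 1 < M /\ b * phi c M < p (y + 1) * g (y + 1).
  near (+oo%R : set_system R) => M; exists M; split; near: M => //.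
  exact: nbhs_pinfty_gt (num_real _).
have yM' : y <= M by lra.
pose f x := p x * g x - b * phi c x.
have fc : {within `[y, M], continuous f}.
  apply/subspace_continuousP => x xyM.
  have pw q : {for x, continuous q} -> q z @[z --> within `[y, M] (nbhs x)] --> q x.
    by move=> ?; apply: cvg_within_filter.
  have gw : g z @[z --> within `[y, M] (nbhs x)] --> g x.
    have /continuous_subspaceW : `[y, M] `<=` `[0, +oo[.
      move=> z /=; rewrite !in_itv/= andbT => /andP[yz _]; exact: le_trans yz.
    by move=> /(_ _ _ g_cont)/subspace_continuousP; apply.
  apply: cvgB; first by apply: cvgM => //; apply: pw; exact: pc.
  apply: cvgMr; apply: pw; exact: der_cont (der_phi _ _).
have fM : 0 < f M.
  rewrite subr_gt0 (lt_le_trans bM)//; apply: ler_pM.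
  - exact: ltW.
  - exact/ltW/flux_gt0.
  - by apply: p_mono; exact: ltW.
  - by apply/ltW/g_incr => //; exact: ltW.
have f0 : f y < 0 by rewrite subr_lt0.
have [|x] := IVT yM' fc (v := 0).
  by rewrite ge_min (ltW f0)/= le_max (ltW fM) orbT.
rewrite in_itv/= le_eqVlt => /andP[/predU1P[<-|yx] _] fx0.
  by rewrite fx0 ltxx in f0.
by exists x => //; apply/eqP; rewrite -subr_eq0 -/(f x) fx0.
Unshelve. all: by end_near. Qed.

Lemma crossing_lt p b x z : 0 < b -> 0 <= x -> x < z -> 0 <= p x ->
  p x <= p z -> 0 < p z ->
  p x * g x = b * phi c x -> p z * g z <> b * phi c z.
Proof.
move=> b0 x0 xz px pxz pz ex ez.
have gx : 0 <= g x.
  by move: x0; rewrite le_eqVlt => /predU1P[<-//|/flux_gt0/ltW].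
have : p z * g z < p x * g x by rewrite ex ez ltr_pM2l// phi_lt.
apply/negP; rewrite -leNgt; apply: ler_pM => //; exact/ltW/g_incr.
Qed.

Lemma crossing_unique p b y x z : 0 < b -> 0 <= y -> y < x -> y < z ->
  (forall s t, s <= t -> p s <= p t) -> (forall s, y < s -> 0 < p s) ->
  p x * g x = b * phi c x -> p z * g z = b * phi c z -> x = z.
Proof.
move=> b0 y0 yx yz pm pp ex ez.
have [xz|zx|//] := ltgtP x z; exfalso.
- apply: (@crossing_lt p b x z) => //; rewrite ?pp ?pm//.
  + exact/ltW/(le_lt_trans y0).
  + exact/ltW/pp.
  + exact/ltW.
- apply: (@crossing_lt p b z x) => //; rewrite ?pp ?pm//.
  + exact/ltW/(le_lt_trans y0).
  + exact/ltW/pp.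
  + exact/ltW.
Qed.

Variable w : R.
Hypothesis w0 : 0 < w.

(** The Stefan condition at x, when g is the flux that arrives at x and y is the
    next line. *)
Definition hits y x := y < x /\ (Phi c x - Phi c y) * g x = w * phi c x.

Lemma hits_exists y : 0 <= y -> exists x, hits y x.
Proof.
move=> y0; have [|x||||x] := @crossing_exists (fun x => Phi c x - Phi c y) w y.
- by [].
- apply: cvgB; first exact: der_cont (der_Phi c x).
  exact: cvg_cst.
- by move=> x z xz; rewrite lerD2r Phi_le.
- by rewrite subr_gt0 Phi_lt// ltrDl.
- by rewrite subrr mul0r mulr_gt0 ?phi_gt0.
- by move=> yx ex; exists x.
Qed.

Lemma hits_unique y x z : 0 <= y -> hits y x -> hits y z -> x = z.
Proof.
move=> y0 [yx ex] [yz ez].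
apply: (@crossing_unique (fun x => Phi c x - Phi c y) w y) => //.
- by move=> s t st; rewrite lerD2r Phi_le.
- by move=> s ys; rewrite subr_gt0 Phi_lt.
Qed.

Lemma hits_lt y y' x x' : 0 <= y -> y < y' -> hits y x -> hits y' x' -> x < x'.
Proof.
move=> y0 yy' [yx ex] [yx' ex']; rewrite ltNge; apply/negP => x'x.
have x'0 : 0 < x' by rewrite (le_lt_trans y0)// (lt_trans yy').
suff : (Phi c x' - Phi c y') * g x' < (Phi c x - Phi c y) * g x.
  rewrite ex ex' ltr_pM2l// ltNge; apply/negP; rewrite negbK.
  move: x'x; rewrite le_eqVlt => /predU1P[->//|x'x].
  by apply/ltW/phi_lt => //; exact: ltW.
have gx' : 0 < g x' by exact: flux_gt0.
have le : g x' <= g x.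
  by move: x'x; rewrite le_eqVlt => /predU1P[->//|x'x]; exact/ltW/g_incr/x'x/ltW.
apply: (@lt_le_trans _ _ ((Phi c x - Phi c y) * g x')).
  rewrite ltr_pM2r//.
  by have := Phi_lt c0 yy'; have := Phi_le c0 x'x; lra.
by rewrite ler_pM2l// subr_gt0 Phi_lt.
Qed.

Lemma hits_flux_lt y y' x x' : 0 <= y -> y < y' -> hits y x -> hits y' x' ->
  (Phi c x' - Phi c y') * phi c y < (Phi c x - Phi c y) * phi c y'.
Proof.
move=> y0 yy' h h'; have xx' := hits_lt y0 yy' h h'.
case: h h' => yx ex [yx' ex'].
have x0 : 0 < x by exact: le_lt_trans yx.
apply: (step_compare c0 w0 (flux_gt0 x0) _ xx' yx yx' ex ex').
exact/ltW/g_incr/xx'/ltW.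
Qed.

(** The product (Phi x - Phi y) (g x / phi x) is the constant w and g / phi
    increases, so Phi x - Phi y decreases as y grows; as Phi x increases, it
    decreases by at most the increment of Phi y. *)
Lemma hits_lipschitz y y' x x' : 0 <= y -> y < y' -> hits y x -> hits y' x' ->
  0 <= (Phi c x - Phi c y) - (Phi c x' - Phi c y') <= Phi c y' - Phi c y.
Proof.
move=> y0 yy' h h'; have xx' := hits_lt y0 yy' h h'.
case: h h' => yx ex [yx' ex'].
have x0 : 0 < x by exact: le_lt_trans yx.
have gx := flux_gt0 x0; have gx' := flux_gt0 (lt_trans x0 xx').
apply/andP; split; last by have := Phi_lt c0 xx'; lra.
rewrite subr_ge0 leNgt; apply/negP => lt.
have : (Phi c x - Phi c y) * g x < (Phi c x' - Phi c y') * g x'.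
  apply: ltr_pM => //; rewrite ?g_incr ?subr_ge0 ?Phi_le//; exact: ltW.
apply/negP; rewrite -leNgt ex ex' ler_pM2l//.
by apply/ltW/phi_lt => //; exact: ltW.
Qed.

Variable X : R -> R.
Hypothesis hX : forall y, 0 <= y -> hits y (X y).

(** The line X y need not be studied itself: the flux depends on it only through
    Phi (X y) - Phi y, which [hits_lipschitz] controls. *)
Lemma hits_gap_cont :
  {within `[0, +oo[, continuous (fun y => Phi c (X y) - Phi c y)}.
Proof.
apply/subspace_continuousP => y /=; rewrite in_itv/= andbT => y0.
apply/cvgrPdist_lt => e e0.
have near_y : \forall z \near y, `|Phi c y - Phi c z| < e.
  by have /cvgrPdist_lt := der_cont (der_Phi c y); apply.
rewrite near_withinE; apply: filterS near_y => z hz.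
rewrite /= in_itv/= andbT /from_subspace => z0.
apply: le_lt_trans hz.
have [yz|zy|->] := ltgtP y z; last by rewrite !subrr !normr0.
- have /andP[h1 h2] := hits_lipschitz y0 yz (hX y0) (hX z0).
  by rewrite ger0_norm// ltr0_norm; [lra|rewrite subr_lt0 Phi_lt].
- have /andP[h1 h2] := hits_lipschitz z0 zy (hX z0) (hX y0).
  by rewrite distrC ger0_norm// gtr0_norm; [lra|rewrite subr_gt0 Phi_lt].
Qed.

End Crossing.

(** * The Stefan conditions as a system for the positions of the lines *)

Section Lines.
Context {R : realType}.
Variables (a d w : nat -> R).
Implicit Types (x : nat -> R) (i m n : nat).

(** Positions are numbered from 1. Phase i occupies ]x_{i+1}, x_i[, and phase 0
    extends to x_0 = +oo, where F = 1. *)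
Definition top x i := if i == 0%N then 1 else Phi (a i) (x i).
Definition gap x i := top x i - Phi (a i) (x i.+1).

(** The last position may be 0: in the Stefan-Dirichlet problem it is the
    boundary. *)
Definition lines x n := (forall i, (1 <= i < n)%N -> x i.+1 < x i) /\ 0 <= x n.

Definition stefan x i :=
  d i * x i / 2 + w i.-1 * phi (a i.-1) (x i) / gap x i.-1 =
  w i * phi (a i) (x i) / gap x i.

Definition system x n := forall i, (1 <= i < n)%N -> stefan x i.

Lemma lines_ge0 x n i : lines x n -> (1 <= i <= n)%N -> 0 <= x i.
Proof.
move=> [xd x0] /andP[i1 ni]; rewrite -(subKn ni).
have: (n - i < n)%N by lia.
elim: (n - i)%N => [|k IH] kn; first by rewrite subn0.
apply: (le_trans (IH _)); first by lia.
by rewrite -subSS subSn; [apply/ltW/xd; lia|lia].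
Qed.

Lemma gap_gt0 m x n i : (forall i, (i <= m)%N -> 0 < a i) ->
  (n <= m)%N -> lines x n -> (i < n)%N -> 0 < gap x i.
Proof.
move=> a0 nm [xd _] ni; have c0 : 0 < a i by apply: a0; lia.
rewrite subr_gt0 /top; case: eqP => [_|i0]; first exact: Phi_lt1.
by apply: Phi_lt => //; apply: xd; lia.
Qed.

End Lines.

(** The system sees the temperatures and conductivities only through
    w_i = k_i (u_{i+1} - u_i); the case w_0 = 0 is u_0 = u_1. *)
Record shooting_data {R : realType} (m : nat) (a d w : nat -> R) : Prop := {
  sd_diffusivity : forall i, (i <= m)%N -> 0 < a i ;
  sd_latent : forall i, (1 <= i <= m)%N -> 0 <= d i ;
  sd_weight0 : 0 <= w 0%N ;
  sd_weight : forall i, (1 <= i < m)%N -> 0 < w i ;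
  sd_degenerate : w 0%N = 0 -> 0 < d 1%N }.

(** * Shooting from the last line *)

Section Shooting.
Context {R : realType}.
Variables (m : nat) (a d w : nat -> R).
Hypothesis S : shooting_data m a d w.

Let a0 i : (i <= m)%N -> 0 < a i. Proof. exact: (sd_diffusivity S). Qed.
Let d0 i : (1 <= i <= m)%N -> 0 <= d i. Proof. exact: (sd_latent S). Qed.
Let w_ge0 : 0 <= w 0. Proof. exact: (sd_weight0 S). Qed.
Let w0 i : (1 <= i < m)%N -> 0 < w i. Proof. exact: (sd_weight S). Qed.
Let wd : w 0 = 0 -> 0 < d 1. Proof. exact: (sd_degenerate S). Qed.
Implicit Types (x : nat -> R) (y z b : R) (i n : nat).

Definition previous_line c v (g : R -> R) y : R := xget 0 (hits c g v y).

(** The flux with which phase n arrives at line n + 1 when that line is at y and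
    the Stefan conditions hold on all earlier lines: they are then determined by
    y, and line n is the one found by [previous_line]. *)
Fixpoint flux n y : R :=
  if n is n'.+1 then
    w n * phi (a n) y /
    (Phi (a n) (previous_line (a n) (w n) (fun z => flux n' z + d n * z / 2) y)
     - Phi (a n) y)
  else w 0 * phi (a 0) y / (1 - Phi (a 0) y).

(** The flux on the warm side of line n + 1, that is after the latent heat. *)
Definition warm_flux n y := flux n y + d n.+1 * y / 2.

Definition prev n y := previous_line (a n) (w n) (warm_flux n.-1) y.

Lemma fluxS n y : flux n.+1 y =
  w n.+1 * phi (a n.+1) y / (Phi (a n.+1) (prev n.+1 y) - Phi (a n.+1) y).
Proof. by []. Qed.

Lemma within_der (f f' : R -> R) (A : set R) : (forall z, is_derive z 1 f (f' z)) ->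
  {within A, continuous f}.
Proof. by move=> df; apply: continuous_subspaceT => z; exact: der_cont (df z). Qed.

Lemma within_ratio c v (K : R -> R) : 0 < c -> {within `[0, +oo[, continuous K} ->
  (forall z, 0 <= z -> 0 < K z) ->
  {within `[0, +oo[, continuous (fun z => v * phi c z / K z)}.
Proof.
move=> c0 /subspace_continuousP Kc K0; apply/subspace_continuousP => z z0.
apply: cvgM.
  apply: cvgMr; apply: cvg_within_filter; exact: der_cont (der_phi _ _).
apply: cvgV; last exact: Kc.
by rewrite gt_eqF// K0//; move: z0; rewrite /= in_itv/= andbT.
Qed.

Lemma warm_flux_cont n : {within `[0, +oo[, continuous (flux n)} ->
  {within `[0, +oo[, continuous (warm_flux n)}.
Proof.
move=> /subspace_continuousP fc; apply/subspace_continuousP => z z0.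
apply: cvgD; first exact: fc.
apply: cvg_within_filter.
exact: der_cont (derM (derM (der_cst (d n.+1) z) (der_id z)) (der_cst _ z)).
Qed.

(** The induction behind the whole argument: continuity and monotonicity of the
    flux at one line give, by [hits_flux_lt] and [hits_gap_cont], the same at the
    next one. When w_0 = 0 the flux at the first line vanishes, and it is the
    latent heat d_1 > 0 that makes the warm flux strictly increasing. *)
Lemma flux_regularity n : (n < m)%N ->
  [/\ {within `[0, +oo[, continuous (flux n)},
      forall y z, 0 <= y -> y < z -> warm_flux n y < warm_flux n z &
      0 <= flux n 0].
Proof.
elim: n => [|n IH] nm.
  have c0 : 0 < a 0 by apply: a0.
  have fi y z : 0 <= y -> y < z ->
      phi (a 0) y / (1 - Phi (a 0) y) < phi (a 0) z / (1 - Phi (a 0) z).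
    move=> y0 yz; rewrite ltr_pdivrMr ?subr_gt0 ?Phi_lt1// mulrAC.
    rewrite ltr_pdivlMr ?subr_gt0 ?Phi_lt1//.
    by rewrite mulrC [ltRHS]mulrC mass_tail.
  have d1 : 0 <= d 1 by apply: d0; lia.
  split.
  - apply: within_ratio => //; last by move=> z _; rewrite subr_gt0 Phi_lt1.
    exact: within_der (fun z => derB (der_cst 1 z) (der_Phi (a 0) z)).
  - move=> y z y0 yz; rewrite /warm_flux /= -!mulrA.
    move: w_ge0; rewrite le_eqVlt => /predU1P[w00|wp].
      rewrite -w00 !mul0r !add0r ltr_pM2l ?wd// ltr_pM2r//.
    by rewrite ltr_leD ?ltr_pM2l ?fi// ler_wpM2l// ler_pM2r// ltW.
  - by rewrite /= Phi0 subr0 divr1 mulr_ge0//; exact/ltW/phi_gt0.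
have nm' : (n < m)%N by lia.
have [fc wi f0] := IH nm'; have wc := warm_flux_cont fc.
have wf0 : 0 <= warm_flux n 0 by rewrite /warm_flux mulr0 mul0r addr0.
have c0 : 0 < a n.+1 by apply: a0; lia.
have v0 : 0 < w n.+1 by apply: w0; lia.
have hX y : 0 <= y -> hits (a n.+1) (warm_flux n) (w n.+1) y (prev n.+1 y).
  by move=> y0; have [x hx] := hits_exists c0 wc wi wf0 v0 y0; exact: (xgetI 0 hx).
have K0 y : 0 <= y -> 0 < Phi (a n.+1) (prev n.+1 y) - Phi (a n.+1) y.
  by move=> /hX[yx _]; rewrite subr_gt0 Phi_lt.
have fi' y z : 0 <= y -> y < z -> flux n.+1 y < flux n.+1 z.
  move=> y0 yz; have z0 := ltW (le_lt_trans y0 yz).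
  have := hits_flux_lt c0 wi wf0 v0 y0 yz (hX _ y0) (hX _ z0).
  rewrite !fluxS -!mulrA ltr_pM2l// ltr_pdivrMr ?K0// mulrAC ltr_pdivlMr ?K0//.
  by rewrite mulrC [ltRHS]mulrC.
have fc' : {within `[0, +oo[, continuous (flux n.+1)}.
  apply: within_ratio => //.
  exact: (hits_gap_cont c0 wi wf0 v0 hX).
split => //.
- move=> y z y0 yz; rewrite /warm_flux ltr_leD ?fi'// ler_pM2r// ler_wpM2l ?d0 ?ltW//; lia.
- by rewrite fluxS divr_ge0// ?ltW ?K0// mulr_gt0 ?phi_gt0.
Qed.

Section Regularity.
Variable n : nat.
Hypothesis nm : (n < m)%N.

Lemma warm_cont : {within `[0, +oo[, continuous (warm_flux n)}.
Proof. by have [fc _ _] := flux_regularity nm; exact: warm_flux_cont. Qed.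

Lemma warm_incr y z : 0 <= y -> y < z -> warm_flux n y < warm_flux n z.
Proof. by have [_ + _] := flux_regularity nm; apply. Qed.

Lemma warm0 : warm_flux n 0 = flux n 0.
Proof. by rewrite /warm_flux mulr0 mul0r addr0. Qed.

Lemma warm0_ge0 : 0 <= warm_flux n 0.
Proof. by rewrite warm0; have [] := flux_regularity nm. Qed.
End Regularity.

Lemma prevP n y : (n.+1 < m)%N -> 0 <= y ->
  hits (a n.+1) (warm_flux n) (w n.+1) y (prev n.+1 y).
Proof.
move=> nm y0; have nm' : (n < m)%N by lia.
have c0 : 0 < a n.+1 by apply: a0; lia.
have v0 : 0 < w n.+1 by apply: w0; lia.
have [x hx] := hits_exists c0 (warm_cont nm') (@warm_incr _ nm') (warm0_ge0 nm') v0 y0.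
exact: (xgetI 0 hx).
Qed.

(** Any solution of the system is traced back from its last line: once the flux
    arriving at a line is known to be the shooting flux, uniqueness of the
    preceding line applies. *)
Lemma system_prev_of_flux x n i : (n <= m)%N -> lines x n -> system a d w x n ->
  (i.+1 < n)%N ->
  w i * phi (a i) (x i.+1) / gap a x i = flux i (x i.+1) ->
  x i.+1 = prev i.+1 (x i.+2).
Proof.
move=> nm xl xs ni e.
have st : stefan a d w x i.+1 by apply: xs; lia.
have xi0 : 0 <= x i.+2 by apply: (lines_ge0 xl); lia.
have im : (i.+1 < m)%N by lia.
have im' : (i < m)%N by lia.
have c0 : 0 < a i.+1 by apply: a0; lia.
have v0 : 0 < w i.+1 by apply: w0; lia.
have g0 : 0 < gap a x i.+1 by apply: (gap_gt0 a0 nm xl); lia.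
apply: (hits_unique c0 (@warm_incr _ im') (warm0_ge0 im') v0 xi0); last exact: prevP.
split; first by apply: xl.1; lia.
move: st; rewrite /stefan /= e.
by rewrite addrC -/(warm_flux i _) => ->; rewrite /gap /top /= mulrC divfK// gt_eqF.
Qed.

Lemma system_flux x n i : (n <= m)%N -> lines x n -> system a d w x n -> (i < n)%N ->
  w i * phi (a i) (x i.+1) / gap a x i = flux i (x i.+1).
Proof.
move=> nm xl xs; elim: i => [//|i IH] ni.
by rewrite fluxS -(system_prev_of_flux nm xl xs ni (IH (ltnW ni))).
Qed.

Lemma system_prev x n i : (n <= m)%N -> lines x n -> system a d w x n ->
  (1 <= i < n)%N -> x i = prev i (x i.+1).
Proof.
case: i => // i nm xl xs ni; apply: (system_prev_of_flux nm xl xs ni).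
exact: (system_flux nm xl xs (ltnW ni)).
Qed.

Lemma system_unique x (z : nat -> R) n i : (n <= m)%N -> lines x n -> system a d w x n ->
  lines z n -> system a d w z n -> x n = z n -> (1 <= i <= n)%N -> x i = z i.
Proof.
move=> nm xl xs zl zs e /andP[i1 ni]; rewrite -(subKn ni).
have: (n - i < n)%N by lia.
elim: (n - i)%N => [|k IH] kn; first by rewrite subn0.
rewrite (system_prev nm xl xs); last by lia.
rewrite (system_prev nm zl zs); last by lia.
by rewrite -subSn; [rewrite subSS IH//; lia|lia].
Qed.

(** The solution of the system whose last line, with number n, is at y. It is
    constant from index n on. *)
Fixpoint chain n y i : R :=
  if n is n'.+1 then if (i <= n')%N then chain n' (prev n' y) i else y else 0.

Lemma chain_last n y i : (n <= i)%N -> (0 < n)%N -> chain n y i = y.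
Proof. by case: n => //= n ni _; rewrite leqNgt ni. Qed.

Lemma chain_system n y : (1 <= n <= m)%N -> 0 <= y ->
  lines (chain n y) n /\ system a d w (chain n y) n.
Proof.
elim: n y => // n IH y nm y0.
have [->|n0] := eqVneq n 0%N.
  by split; [split => //; lia|move=> i; lia].
have [n' en] : exists n', n = n'.+1 by exists n.-1; lia.
have [p1 p2] : hits (a n) (warm_flux n.-1) (w n) y (prev n y).
  by rewrite en; apply: prevP => //; lia.
have [[ld l0] ls] := IH (prev n y) ltac:(lia) (ltW (le_lt_trans y0 p1)).
have ce i : (i <= n)%N -> chain n.+1 y i = chain n (prev n y) i.
  by rewrite /= => ->.
have cn : chain n (prev n y) n = prev n y by apply: chain_last; lia.
have cS : chain n.+1 y n.+1 = y by rewrite chain_last.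
move: (chain n.+1 y) ce cS => c ce cS.
split.
  split; last by rewrite cS.
  move=> i ni; rewrite [ltRHS]ce; last lia.
  have [->|ni'] := eqVneq i n; first by rewrite cS cn.
  by rewrite ce; [apply: ld; lia|lia].
move=> i ni.
have egap j : (j < n)%N -> gap a c j = gap a (chain n (prev n y)) j.
  by move=> jn; rewrite /gap /top !ce//; lia.
have [e|ni'] := eqVneq i n; last first.
  by rewrite /stefan !ce ?egap; try lia; apply: ls; lia.
subst i; rewrite /stefan egap; last lia.
rewrite ce// cn.
have /(_ _)/esym := @system_flux (chain n (prev n y)) n n.-1 ltac:(lia)
  (conj ld l0) ls.
rewrite prednK; last lia.
rewrite cn => <-; last lia.
rewrite addrC -[in X in d X](@prednK n); last lia.
rewrite -[LHS]/(warm_flux n.-1 (prev n y)) -p2 /gap /top (negbTE n0) ce// cn cS.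
rewrite [RHS]mulrC mulKf// gt_eqF// subr_gt0 Phi_lt//; apply: a0; lia.
Qed.

Lemma phi_at0 c : phi c 0 = (Num.sqrt pi * c)^-1 :> R.
Proof. by rewrite phiE mul0r expr0n/= mul0r oppr0 expR0 mul1r. Qed.

Lemma flux_at0 n :
  flux n.+1 0 = w n.+1 / (Num.sqrt pi * a n.+1 * Phi (a n.+1) (prev n.+1 0)).
Proof.
by rewrite fluxS phi_at0 Phi0 subr0 -mulrA -invfM.
Qed.

(** With X the line that precedes 0, the flux at 0 is warm_flux X * phi 0 / phi X,
    hence at least warm_flux X, which exceeds the flux one line earlier. *)
Lemma flux_at0_le n : (n.+1 < m)%N -> flux n 0 <= flux n.+1 0.
Proof.
move=> nm; have c0 : 0 < a n.+1 by apply: a0; lia.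
have [p1 p2] := prevP nm (lexx 0).
rewrite Phi0 subr0 in p2.
set X := prev n.+1 0 in p1 p2.
have PX : 0 < Phi (a n.+1) X by rewrite -(Phi0 (a n.+1)) Phi_lt.
have wX : warm_flux n 0 < warm_flux n X by apply: warm_incr => //; lia.
have n0 : 0 <= warm_flux n 0 by apply: warm0_ge0; lia.
rewrite fluxS -/X Phi0 subr0 -warm0 ler_pdivlMr//.
apply: (@le_trans _ _ (w n.+1 * phi (a n.+1) X)).
  by rewrite -p2 mulrC ler_pM2l// ltW.
by rewrite ler_pM2l; [apply/ltW/phi_lt|apply: w0; lia].
Qed.

(** The coefficient for which amplitude * phi is the flux b exp (- z^2 / (4 a_n^2))
    of a phase that satisfies the Neumann condition b = - b_N at z = 0. *)
Definition amplitude n b := b * (Num.sqrt pi * a n).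

Lemma amplitude_gt0 n b : (n <= m)%N -> 0 < b -> 0 < amplitude n b.
Proof. by move=> nm b0; rewrite !mulr_gt0 ?sqrtpi_gt0 ?a0. Qed.

Lemma amplitude_phi n b y :
  (n <= m)%N -> amplitude n b * phi (a n) y = b * expR (- ((y / a n) ^+ 2 / 4)).
Proof.
move=> nm; rewrite /amplitude phiE; field.
by rewrite !gt_eqF ?sqrtpi_gt0 ?a0.
Qed.

(** On the last line an increasing flux has to meet a decreasing one, whose value
    at 0 is b: there is a root exactly when the flux at 0 is below b. *)
Lemma neumann_root_exists n b : (n < m)%N -> flux n 0 < b ->
  exists2 y, 0 < y & warm_flux n y = amplitude n.+1 b * phi (a n.+1) y.
Proof.
move=> nm fb; have c0 : 0 < a n.+1 by apply: a0; lia.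
have [|//|//|||y y0] := crossing_exists c0 (warm_cont nm) (@warm_incr _ nm)
  (warm0_ge0 nm) (p := fun=> 1) (b := amplitude n.+1 b) (y := 0).
- by [].
- by move=> x; exact: cvg_cst.
- by [].
- rewrite mul1r amplitude_phi; last lia.
  by rewrite mul0r expr0n/= mul0r oppr0 expR0 mulr1 warm0.
by rewrite mul1r => e; exists y.
Qed.

Lemma neumann_root_unique n b y z : (n < m)%N -> 0 < b -> 0 < y -> 0 < z ->
  warm_flux n y = amplitude n.+1 b * phi (a n.+1) y ->
  warm_flux n z = amplitude n.+1 b * phi (a n.+1) z -> y = z.
Proof.
move=> nm b0 y0 z0 ey ez; have c0 : 0 < a n.+1 by apply: a0; lia.
apply: (@crossing_unique _ (a n.+1) (warm_flux n) c0 (@warm_incr _ nm) (warm0_ge0 nm)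
  (fun=> 1) (amplitude n.+1 b) 0) => //.
- by apply: amplitude_gt0 => //; lia.
- by rewrite mul1r.
- by rewrite mul1r.
Qed.

Lemma neumann_root_flux n b y : (n < m)%N -> 0 < b -> 0 < y ->
  warm_flux n y = amplitude n.+1 b * phi (a n.+1) y -> flux n 0 < b.
Proof.
move=> nm b0 y0; rewrite amplitude_phi; last lia.
move=> e; rewrite -warm0; apply: (lt_le_trans (warm_incr nm (lexx 0) y0)).
rewrite e ger_pMr// -expR0 ler_expR oppr_le0 divr_ge0//; exact: sqr_ge0.
Qed.

(** Both inequalities say that y does not lie beyond X, the line that precedes 0
    in the next chain: warm_flux / phi increases, takes the value amplitude at y
    and w / Phi X at X. *)
Lemma neumann_top n b y : (n.+1 < m)%N -> 0 < b -> 0 < y ->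
  warm_flux n y = amplitude n.+1 b * phi (a n.+1) y ->
  amplitude n.+1 b * Phi (a n.+1) y <= w n.+1 <-> b <= flux n.+1 0.
Proof.
move=> nm b0 y0 ey; have c0 : 0 < a n.+1 by apply: a0; lia.
have nm' : (n < m)%N by lia.
have [X0 eX] := prevP nm (lexx 0); rewrite Phi0 subr0 in eX.
rewrite flux_at0//; set X := prev n.+1 0 in X0 eX *.
have PX : 0 < Phi (a n.+1) X by rewrite -(Phi0 (a n.+1)) Phi_lt.
have B0 : 0 < amplitude n.+1 b by apply: amplitude_gt0 => //; lia.
rewrite ler_pdivlMr ?mulr_gt0 ?sqrtpi_gt0// mulrA -/(amplitude _ _).
set B := amplitude _ _ in ey B0 *.
have pX : 0 < phi (a n.+1) X by exact: phi_gt0.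
have [yX|Xy] := leP y X.
  have BX : B * Phi (a n.+1) X <= w n.+1.
    rewrite -(ler_pM2r pX) -eX mulrAC mulrC ler_pM2l//.
    move: yX; rewrite le_eqVlt => /predU1P[<-|yX]; first by rewrite ey.
    apply: (@le_trans _ _ (B * phi (a n.+1) y)); first by rewrite ler_pM2l// ltW// phi_lt// ltW.
    by rewrite -ey ltW// warm_incr// ltW.
  split=> // _; apply: le_trans BX; rewrite ler_pM2l//; exact: Phi_le.
have BX : w n.+1 < B * Phi (a n.+1) X.
  rewrite -(ltr_pM2r pX) -eX mulrAC mulrC ltr_pM2r//.
  apply: (lt_trans (warm_incr nm' (ltW X0) Xy)).
  by rewrite ey ltr_pM2l// phi_lt// ltW.
split=> h; exfalso.
  have := lt_trans BX (_ : _ < B * Phi (a n.+1) y); rewrite ltr_pM2l// => /(_ (Phi_lt c0 Xy)).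
  by rewrite ltNge h.
by move: BX; rewrite ltNge h.
Qed.

End Shooting.

(** * Strict concavity of the logarithm of the mass of a layer *)

Section LogConcavity.
Context {R : realType}.
Implicit Types c x y p q : R.

(** The mean value theorem for phi + t / (2 c^2) Phi, whose derivative is
    (t - z) / (2 c^2) phi; take t = y and t = x. *)
Lemma phi_increment c x y : 0 < c -> y < x ->
  y / (2 * c ^+ 2) * (Phi c x - Phi c y) < phi c y - phi c x <
  x / (2 * c ^+ 2) * (Phi c x - Phi c y).
Proof.
move=> c0 yx; set k := (2 * c ^+ 2)^-1.
have k0 : 0 < k by rewrite invr_gt0 mulr_gt0// exprn_gt0.
have h t z := derD (der_phi c z) (derZ (t * k) (der_Phi c z)).
have [s /andP[ys sx] e] := der_MVT yx (fun z _ => h y z).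
have [s' /andP[ys' sx'] e'] := der_MVT yx (fun z _ => h x z).
have neg : (y * k * phi c s - s * k * phi c s) * (x - y) < 0.
  by rewrite pmulr_llt0 ?subr_gt0// subr_lt0 ltr_pM2r ?phi_gt0// ltr_pM2r.
have pos : 0 < (x * k * phi c s' - s' * k * phi c s') * (x - y).
  by rewrite pmulr_lgt0 ?subr_gt0// ltr_pM2r ?phi_gt0// ltr_pM2r.
rewrite mulNr -/k in e; rewrite mulNr -/k in e'.
by apply/andP; split; lra.
Qed.

(** Negative definiteness of the Hessian of ln (Phi x - Phi y), in the direction
    (p, q). *)
Lemma log_gap_quadratic c x y p q : 0 < c -> 0 <= y -> y < x -> (p, q) != (0, 0) ->
  (p * (- (x / (2 * c ^+ 2)) * phi c x * p) - q * (- (y / (2 * c ^+ 2)) * phi c y * q))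
    * (Phi c x - Phi c y) < (p * phi c x - q * phi c y) ^+ 2.
Proof.
move=> c0 y0 yx pq; have /andP[] := phi_increment c0 yx.
set k := (2 * c ^+ 2)^-1; set D := Phi c x - Phi c y.
have := phi_gt0 x c0; have := phi_gt0 y c0.
set A := phi c x; set B := phi c y => B0 A0 h1 h2.
rewrite -subr_gt0.
(* Completing the square: by [phi_increment] the terms on the right are
   nonnegative, and not all of them vanish. *)
have -> : (p * A - q * B) ^+ 2 - (p * (- (x * k) * A * p) - q * (- (y * k) * B * q)) * D
  = A * (B * (q - p) ^+ 2 + p ^+ 2 * (x * k * D - (B - A)))
    + q ^+ 2 * B * ((B - A) - y * k * D) by ring.
have [p0|p0] := eqVneq p 0.
  have q0 : q != 0 by apply: contraNneq pq => ->; rewrite p0.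
  rewrite p0 subr0 expr0n/= mul0r addr0.
  have q2 : 0 < q ^+ 2 by rewrite exprn_even_gt0.
  apply: ltr_wpDr; last by rewrite mulr_gt0 ?(mulr_gt0 B0).
  apply: mulr_ge0; last by rewrite subr_ge0 ltW.
  by apply: mulr_ge0; exact: ltW.
have p2 : 0 < p ^+ 2 by rewrite exprn_even_gt0.
apply: ltr_wpDr.
  by apply: mulr_ge0; [apply: mulr_ge0; [exact: sqr_ge0|exact: ltW]|rewrite subr_ge0 ltW].
rewrite mulr_gt0//; apply: ltr_wpDl; last by rewrite mulr_gt0// subr_gt0.
by apply: mulr_ge0; [exact: ltW|exact: sqr_ge0].
Qed.

(** A strictly concave function lies below its tangent plane. *)
Lemma log_gap_tangent c x y x0 y0 : 0 < c -> 0 <= y -> y < x -> 0 <= y0 -> y0 < x0 ->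
  (x, y) != (x0, y0) ->
  ln (Phi c x - Phi c y) - ln (Phi c x0 - Phi c y0) <
  ((x - x0) * phi c x0 - (y - y0) * phi c y0) / (Phi c x0 - Phi c y0).
Proof.
move=> c0 y_ge0 yx y0_ge0 y0x0 ne.
(* Restrict to the segment from (x0, y0) to (x, y): N / D is the derivative of
   ln D, and it decreases. *)
pose X t := x0 + t * (x - x0); pose Y t := y0 + t * (y - y0).
pose D t := Phi c (X t) - Phi c (Y t).
pose N t := (x - x0) * phi c (X t) - (y - y0) * phi c (Y t).
pose N' t := (x - x0) * (- (X t / (2 * c ^+ 2)) * phi c (X t) * (x - x0)) -
             (y - y0) * (- (Y t / (2 * c ^+ 2)) * phi c (Y t) * (y - y0)).
have Y0 (t : R) : 0 <= t <= 1 -> 0 <= Y t.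
  move=> /andP[t0 t1]; rewrite (_ : Y t = (1 - t) * y0 + t * y); last by rewrite /Y; ring.
  by rewrite addr_ge0// mulr_ge0// subr_ge0.
have XY (t : R) : 0 <= t <= 1 -> Y t < X t.
  move=> /andP[t0 t1]; rewrite -subr_gt0.
  rewrite (_ : X t - Y t = (1 - t) * (x0 - y0) + t * (x - y)); last by rewrite /X /Y; ring.
  move: t0; rewrite le_eqVlt => /predU1P[<-|t0]; first by lra.
  by rewrite ltr_wpDl// ?mulr_gt0 ?subr_gt0// mulr_ge0 ?subr_ge0// ltW.
have D0 (t : R) : 0 <= t <= 1 -> 0 < D t by move=> /XY ?; rewrite subr_gt0 Phi_lt.
have daff (u v t : R) : is_derive t 1 (fun t : R => u + t * v) v.
  apply: (der_eq (derD (der_cst u t) (derM (der_id t) (der_cst v t)))).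
  by rewrite mulr0 addr0 mul1r add0r.
have dD (t : R) : is_derive t 1 D (N t).
  apply: (der_eq (derB (der_comp (der_Phi c _) (daff _ _ t))
    (der_comp (der_Phi c _) (daff _ _ t)))).
  by rewrite /N ![phi _ _ * _]mulrC.
have dN (t : R) : is_derive t 1 N (N' t).
  exact: (derB (derZ _ (der_comp (der_phi c _) (daff _ _ t)))
    (derZ _ (der_comp (der_phi c _) (daff _ _ t)))).
have dL (t : R) : 0 <= t <= 1 -> is_derive t 1 (fun t => ln (D t)) (N t / D t).
  move=> t01; apply: (der_eq (der_comp (is_derive1_ln (D0 t t01)) (dD t))).
  by rewrite mulrC.
have dQ (t : R) : 0 <= t <= 1 -> is_derive t 1 (fun t => N t / D t)
    ((N' t * D t - N t ^+ 2) / D t ^+ 2).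
  move=> t01; have Dn : D t != 0 by rewrite gt_eqF ?D0.
  apply: (der_eq (derM (dN t) (derV Dn (dD t)))).
  by field.
have [s /andP[s0 s1]] := der_MVT ltr01 dL.
rewrite subr0 mulr1.
have dQs (z : R) : 0 <= z <= s -> is_derive z 1 (fun t => N t / D t)
    ((N' z * D z - N z ^+ 2) / D z ^+ 2).
  by move=> /andP[z0 zs]; apply: dQ; rewrite z0 (le_trans zs)// ltW.
have [r /andP[r0 rs] eQ] := der_MVT s0 dQs.
have r01 : 0 <= r <= 1 by rewrite (ltW r0) (le_trans (ltW rs))// ltW.
have neg : (N' r * D r - N r ^+ 2) / D r ^+ 2 * (s - 0) < 0.
  rewrite subr0 pmulr_llt0// pmulr_llt0 ?invr_gt0 ?exprn_gt0 ?D0// subr_lt0.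
  apply: log_gap_quadratic => //; [exact: Y0|exact: XY|].
  by move: ne; rewrite !xpair_eqE !subr_eq0.
rewrite -eQ subr_lt0 in neg.
have X0 : X 0 = x0 by rewrite /X mul0r addr0.
have X1 : X 1 = x by rewrite /X mul1r addrC subrK.
have Y0' : Y 0 = y0 by rewrite /Y mul0r addr0.
have Y1 : Y 1 = y by rewrite /Y mul1r addrC subrK.
move=> e; rewrite /D X1 Y1 X0 Y0' in e; rewrite e.
by apply: (lt_le_trans neg); rewrite /N /D X0 Y0'.
Qed.

(** In the outermost phase the hazard rate phi / (1 - Phi) increases, by
    [mass_tail]. *)
Lemma log_tail_tangent c y y0 : 0 < c ->
  ln (1 - Phi c y) - ln (1 - Phi c y0) <= - ((y - y0) * phi c y0) / (1 - Phi c y0).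
Proof.
move=> c0; pose h z := phi c z / (1 - Phi c z).
have p z : 0 < 1 - Phi c z :> R by rewrite subr_gt0 Phi_lt1.
have h_lt u v : u < v -> h u < h v.
  move=> uv; rewrite /h ltr_pdivrMr// mulrAC ltr_pdivlMr//.
  by rewrite mulrC [ltRHS]mulrC mass_tail.
pose g z : R := 1 - Phi c z.
have dl (z : R) : is_derive z 1 (fun z => ln (g z)) (- h z).
  have dg : is_derive z 1 g (- phi c z).
    by apply: (der_eq (derB (der_cst 1 z) (der_Phi c z))); rewrite sub0r.
  have gz : 0 < g z by exact: p.
  by apply: (der_eq (der_comp (is_derive1_ln gz) dg)); rewrite mulrN mulrC.
rewrite mulNr -mulrA -/(h y0).
have [yy0|y0y|->] := ltgtP y y0; last by rewrite !subrr mul0r oppr0.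
- have [s /andP[ys sy] e] := der_MVT yy0 (fun z _ => dl z).
  rewrite -opprB e -mulNr -mulNr opprK mulrC opprB ler_pM2l ?subr_gt0//.
  exact/ltW/h_lt.
- have [s /andP[ys sy] e] := der_MVT y0y (fun z _ => dl z).
  rewrite e mulNr lerN2 mulrC ler_pM2r ?subr_gt0//.
  exact/ltW/h_lt.
Qed.

End LogConcavity.

(** * The chain minimizes the Dirichlet energy *)

Section Energy.
Context {R : realType}.
Variables (m : nat) (a d w : nat -> R).
Hypothesis S : shooting_data m a d w.

Let a0 i : (i <= m)%N -> 0 < a i. Proof. exact: (sd_diffusivity S). Qed.
Let d0 i : (1 <= i <= m)%N -> 0 <= d i. Proof. exact: (sd_latent S). Qed.
Let w_ge0 : 0 <= w 0. Proof. exact: (sd_weight0 S). Qed.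
Let w0 i : (1 <= i < m)%N -> 0 < w i. Proof. exact: (sd_weight S). Qed.
Implicit Types (x z : nat -> R).

Definition energy x n :=
  - (\sum_(0 <= i < n) w i * ln (gap a x i))
  + 4^-1 * \sum_(1 <= i < n) d i * x i ^+ 2.

Lemma energyS x n : (1 <= n)%N ->
  energy x n.+1 = energy x n - w n * ln (gap a x n) + 4^-1 * (d n * x n ^+ 2).
Proof.
by move=> n1; rewrite /energy big_nat_recr//= big_nat_recr//=; ring.
Qed.

(** Each logarithm is bounded by its tangent at x, and each square too. Summed up
    over the phases, the linear terms cancel at every line by the Stefan condition,
    except the one at line n. *)
Lemma energy_diff x z n : (1 <= n <= m)%N -> lines x n -> system a d w x n ->
  lines z n ->
  w n.-1 * phi (a n.-1) (x n) / gap a x n.-1 * (z n - x n) <= energy z n - energy x n /\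
  ((exists2 i, (1 <= i < n)%N & x i != z i) ->
   w n.-1 * phi (a n.-1) (x n) / gap a x n.-1 * (z n - x n) < energy z n - energy x n).
Proof.
elim: n => // n IH nm xl xs zl.
have lw (v : nat -> R) : lines v n.+1 -> (0 < n)%N -> lines v n.
  move=> vl n0; split; last by apply: (lines_ge0 vl); lia.
  by move=> i ni; apply: vl.1; lia.
have c0 i : (i <= n)%N -> 0 < a i by move=> ni; apply: a0; lia.
have [n0|n0] := posnP n.
  subst n; split; last by case=> i; lia.
  have := log_tail_tangent (z 1) (x 1) (c0 _ (leqnn 0)).
  move=> /(ler_wpM2l w_ge0); rewrite /energy !big_nat1 !big_geq// !mulr0 !addr0 /gap /top /=.
  set q := (1 - _)^-1; set L := ln _; set L' := ln _ => h.
  have -> : w 0 * phi (a 0) (x 1) * q * (z 1 - x 1) =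
    - (w 0 * (- ((z 1 - x 1) * phi (a 0) (x 1)) * q)) by ring.
  by rewrite mulrBr in h; lra.
have nm1 : (n < m)%N by case/andP: nm.
have xs' : system a d w x n.
  by move=> i /andP[i1 ni]; apply: xs; rewrite i1 ltnS ltnW.
have [IH1 IH2] := IH ltac:(by rewrite n0 ltnW) (lw _ xl n0) xs' (lw _ zl n0).
have wn : 0 < w n by apply: w0; rewrite n0.
have dn : 0 <= d n by apply: d0; rewrite n0 ltnW.
have st : stefan a d w x n by apply: xs; rewrite n0 ltnSn.
have xn1 : 0 <= x n.+1 by apply: (lines_ge0 xl); rewrite ltnSn.
have zn1 : 0 <= z n.+1 by apply: (lines_ge0 zl); rewrite ltnSn.
have xd : x n.+1 < x n by apply: xl.1; rewrite n0 ltnSn.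
have zd : z n.+1 < z n by apply: zl.1; rewrite n0 ltnSn.
have g0 : 0 < gap a x n by apply: (gap_gt0 a0 nm1 xl).
rewrite !energyS//=.
have sq : 0 <= 4^-1 * (d n * (z n - x n) ^+ 2).
  by rewrite mulr_ge0 ?invr_ge0// mulr_ge0// sqr_ge0.
have en : gap a x n = Phi (a n) (x n) - Phi (a n) (x n.+1).
  by rewrite /gap /top; case: eqP n0 => // ->.
have ezn : gap a z n = Phi (a n) (z n) - Phi (a n) (z n.+1).
  by rewrite /gap /top; case: eqP n0 => // ->.
rewrite /stefan in st.
set C := w n * phi (a n) (x n.+1) / gap a x n.
set H := w n * phi (a n) (x n) / gap a x n in st.
set C' := w n.-1 * _ / _ in st IH1 IH2.
have stz : d n * x n / 2 * (z n - x n) + C' * (z n - x n) = H * (z n - x n).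
  by rewrite -st; ring.
have [/eqP|ne] := eqVneq (z n, z n.+1) (x n, x n.+1).
  rewrite xpair_eqE => /andP[/eqP e1 /eqP e2].
  rewrite ezn e1 e2 -en subrr mulr0; rewrite e1 subrr mulr0 in IH1 IH2.
  split; first by lra.
  move=> [i ni xi]; suff : 0 < energy z n - energy x n by lra.
  apply: IH2; exists i => //; case/andP: ni => -> /=.
  rewrite ltnS leq_eqVlt => /predU1P[ei|//].
  by move: xi; rewrite ei e1 eqxx.
have := log_gap_tangent (c0 _ (leqnn n)) zn1 zd xn1 xd ne.
rewrite -en -ezn -(ltr_pM2l wn) => tg.
have etg : w n * (((z n - x n) * phi (a n) (x n) -
     (z n.+1 - x n.+1) * phi (a n) (x n.+1)) / gap a x n) =
    H * (z n - x n) - C * (z n.+1 - x n.+1).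
  by rewrite /H /C; field; rewrite gt_eqF.
rewrite etg in tg.
have h : C * (z n.+1 - x n.+1) < energy z n - w n * ln (gap a z n) +
  4^-1 * (d n * z n ^+ 2) - (energy x n - w n * ln (gap a x n) + 4^-1 * (d n * x n ^+ 2)).
  lra.
by split => //; exact: ltW.
Qed.

(** Both lists end at the boundary, so the remaining linear term is 0. *)
Lemma energy_lt x z n : (1 <= n <= m)%N -> lines x n -> system a d w x n ->
  lines z n -> x n = z n -> (exists2 i, (1 <= i < n)%N & x i != z i) ->
  energy x n < energy z n.
Proof.
move=> nm xl xs zl e ne; have [_ /(_ ne)] := energy_diff nm xl xs zl.
by rewrite e subrr mulr0 subr_gt0.
Qed.

End Energy.

(** * Self-similar solutions of the heat equation *)

Lemma cvg_near_eq {R : realType} {T : Type} {G : set_system T} {GF : Filter G}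
    (f g : T -> R) (l : R) :
  (\forall y \near G, f y = g y) -> g @ G --> l -> f @ G --> l.
Proof.
move=> fg; apply: cvg_trans; apply: near_eq_cvg.
by apply: filterS fg => y ->.
Qed.

Section HeatKernel.
Context {R : realType}.
Implicit Types c A B t x : R.

(** A self-similar solution of u_t = c^2 u_xx, followed by its partial
    derivatives. *)
Definition selfsim c A B t x : R := A - B * Phi c (x / Num.sqrt t).
Definition selfsim_x c B t x : R := - (B * phi c (x / Num.sqrt t) / Num.sqrt t).
Definition selfsim_t c B t x : R :=
  B * phi c (x / Num.sqrt t) * x / (2 * t * Num.sqrt t).
Definition selfsim_xx c B t x : R :=
  B * phi c (x / Num.sqrt t) * x / (Num.sqrt t * (2 * c ^+ 2) * t).

Lemma der_selfsim_x c A B t x : is_derive x 1 (selfsim c A B t) (selfsim_x c B t x).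
Proof.
apply: (der_eq (derB (der_cst A x) (derZ B (der_comp (der_Phi c _)
  (der_divr (Num.sqrt t) x))))).
by rewrite sub0r /selfsim_x mulrA.
Qed.

Lemma der_selfsim_xx c B t x : 0 < c -> 0 < t ->
  is_derive x 1 (selfsim_x c B t) (selfsim_xx c B t x).
Proof.
move=> c0 t0; have st : 0 < Num.sqrt t by rewrite sqrtr_gt0.
apply: (der_eq (derN (derM (derZ B (der_comp (der_phi c _)
  (der_divr (Num.sqrt t) x))) (der_cst (Num.sqrt t)^-1 x)))).
have ts := esym (sqr_sqrtr (ltW t0)).
rewrite /selfsim_xx; set s := Num.sqrt t in st ts *.
by rewrite ts; field; rewrite !gt_eqF.
Qed.

Lemma der_selfsim_t c A B t x : 0 < t ->
  is_derive t 1 (fun t => selfsim c A B t x) (selfsim_t c B t x).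
Proof.
move=> t0; have st : 0 < Num.sqrt t by rewrite sqrtr_gt0.
have st' : Num.sqrt t != 0 by rewrite gt_eqF.
have dq := derZ x (derV st' (is_derive1_sqrt t0)).
apply: (der_eq (derB (der_cst A t) (derZ B (der_comp (der_Phi c _) dq)))).
by rewrite /selfsim_t (sqr_sqrtr (ltW t0)); field; rewrite st' gt_eqF.
Qed.

Lemma selfsim_heat c B t x : 0 < c -> 0 < t ->
  selfsim_t c B t x = c ^+ 2 * selfsim_xx c B t x.
Proof.
move=> c0 t0; rewrite /selfsim_t /selfsim_xx; field.
by rewrite !gt_eqF ?sqrtr_gt0.
Qed.

Lemma cvg_ratio (p : R * R) : 0 < p.1 ->
  {for p, continuous (fun p : R * R => p.2 / Num.sqrt p.1)}.
Proof.
move=> p0; apply: cvgM; first exact: cvg_snd.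
apply: cvgV; first by rewrite gt_eqF ?sqrtr_gt0.
apply: (cvg_comp _ _ cvg_fst); exact: sqrt_continuous.
Qed.

Lemma cvg_kernel c B (p : R * R) : 0 < p.1 ->
  {for p, continuous (fun p : R * R => B * phi c (p.2 / Num.sqrt p.1))}.
Proof.
move=> p0; apply: cvgMr; apply: (cvg_comp _ _ (cvg_ratio p0)).
exact: der_cont (der_phi c _).
Qed.

Lemma cvg_sqrt_fst (p : R * R) : {for p, continuous (fun p : R * R => Num.sqrt p.1)}.
Proof. by apply: (cvg_comp _ _ cvg_fst); exact: sqrt_continuous. Qed.

Lemma continuous_selfsim_x c B (p : R * R) : 0 < p.1 ->
  {for p, continuous (fun p : R * R => selfsim_x c B p.1 p.2)}.
Proof.
move=> p0; apply: cvgN; apply: cvgM; first exact: cvg_kernel.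
apply: cvgV; first by rewrite gt_eqF ?sqrtr_gt0.
exact: cvg_sqrt_fst.
Qed.

Lemma continuous_selfsim_t c B (p : R * R) : 0 < p.1 ->
  {for p, continuous (fun p : R * R => selfsim_t c B p.1 p.2)}.
Proof.
move=> p0; apply: cvgM; first by apply: cvgM; [exact: cvg_kernel|exact: cvg_snd].
apply: cvgV; first by rewrite gt_eqF// !mulr_gt0 ?sqrtr_gt0.
by apply: cvgM; [apply: cvgMr; exact: cvg_fst|exact: cvg_sqrt_fst].
Qed.

Lemma continuous_selfsim_xx c B (p : R * R) : 0 < c -> 0 < p.1 ->
  {for p, continuous (fun p : R * R => selfsim_xx c B p.1 p.2)}.
Proof.
move=> c0 p0; apply: cvgM; first by apply: cvgM; [exact: cvg_kernel|exact: cvg_snd].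
apply: cvgV.
  by rewrite gt_eqF// mulr_gt0// mulr_gt0 ?sqrtr_gt0// mulr_gt0// exprn_gt0.
by apply: cvgM; [apply: cvgMl; exact: cvg_sqrt_fst|exact: cvg_fst].
Qed.

End HeatKernel.

(** * Temperature ranges of the phases *)

Section Temperatures.
Context {R : realType}.
Variables (m : nat) (u_ : nat -> R).

Lemma in_phaseS i v : (1 <= i)%N -> in_phase m u_ i v -> phase_domain m u_ i v.
Proof. by move=> i1 [//|[i0 _ _]]; lia. Qed.

Lemma phase_domainP i v : (i <= m)%N ->
  phase_domain m u_ i v <-> u_ i < v /\ ((i < m)%N -> v < u_ i.+1).
Proof.
move=> im; rewrite /phase_domain /temp im lte_fin.
case: (ltnP i m) => im'; first by rewrite lte_fin; split => -[? h]; split=> //; exact: h.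
by split => -[? _]; split=> //; rewrite ltry.
Qed.

Hypothesis hu : forall i, (1 <= i < m)%N -> u_ i < u_ i.+1.

Lemma temp_lt i j : (1 <= i)%N -> (i < j <= m)%N -> u_ i < u_ j.
Proof.
move=> i1; elim: j => // j IH ij.
have [<-|ne] := eqVneq i j; first by apply: hu; lia.
by apply: (lt_trans (IH _)); [lia|apply: hu; lia].
Qed.

Hypothesis hu01 : u_ 0%N <= u_ 1%N.

Lemma temp_le i j : (i <= j <= m)%N -> u_ i <= u_ j.
Proof.
move=> ij; have [->//|ne] := eqVneq i j.
case: i ij ne => [|i] ij ne; last by apply/ltW/temp_lt => //; lia.
apply: (le_trans hu01); have [<-//|ne1] := eqVneq 1%N j.
by apply/ltW/temp_lt => //; lia.
Qed.

Lemma phase_domain_unique i j v : (i <= m)%N -> (j <= m)%N ->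
  phase_domain m u_ i v -> in_phase m u_ j v -> i = j.
Proof.
move=> im jm /(phase_domainP _ im)[ui vi] [/(phase_domainP _ jm)[uj vj]|[-> _ vE]].
- have [ij|ji|//] := ltngtP i j.
    have : u_ i.+1 <= u_ j by apply: temp_le; lia.
    by have := vi ltac:(lia); move=> h1 h2; exfalso; lra.
  have : u_ j.+1 <= u_ i by apply: temp_le; lia.
  by have := vj ltac:(lia); move=> h1 h2; exfalso; lra.
- have : u_ 0 <= u_ i by apply: temp_le; lia.
  by rewrite -vE leNgt ui.
Qed.

Lemma phase_domain_line i j : (i <= m)%N -> (j <= m)%N -> ~ phase_domain m u_ j (u_ i).
Proof.
move=> im jm /(phase_domainP _ jm)[uj vj].
have [ij|ji] := leqP i j.
  have : u_ i <= u_ j by apply: temp_le; lia.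
  by rewrite leNgt uj.
have : u_ j.+1 <= u_ i by apply: temp_le; lia.
by rewrite leNgt vj//; lia.
Qed.

End Temperatures.

(** * Profiles with prescribed transition lines *)

(** The interval occupied by phase i; for i = 0 it is a half-line. *)
Definition zone {R : realType} (x : nat -> R) i (z : R) :=
  x i.+1 < z /\ (i = 0%N \/ z < x i).

(** A profile of type n, with real positions x_1 > ... > x_n of the lines and
    x_{n+1} = 0 for the boundary. In phase i the profile is affine in - Phi_i, with
    coefficient s_i. The field [mp_slope] is the continuity at the line i + 1, and
    [mp_slope_top] bounds the boundary value by u_{n+1}. *)
Record melting_profile {R : realType} (m n : nat) (u_ a x s : nat -> R)
    (U : R -> R) : Prop := {
  mp_temp01 : u_ 0%N <= u_ 1%N ;
  mp_temp : forall i, (1 <= i < m)%N -> u_ i < u_ i.+1 ;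
  mp_diff_gt0 : forall i, (i <= m)%N -> 0 < a i ;
  mp_type : (n <= m)%N ;
  mp_boundary : x n.+1 = 0 ;
  mp_lines : forall i, (1 <= i <= n)%N -> x i.+1 < x i ;
  mp_zone : forall i z, (i <= n)%N -> zone x i z ->
    U z = u_ i + s i * (top a x i - Phi (a i) z) ;
  mp_line : forall i, (1 <= i <= n)%N -> U (x i) = u_ i ;
  mp_slope : forall i, (i < n)%N -> s i * gap a x i = u_ i.+1 - u_ i ;
  mp_slope_last : 0 < s n ;
  mp_slope_top : (n < m)%N -> s n * top a x n <= u_ n.+1 - u_ n }.

Section Profile.
Context {R : realType}.
Variables (m n : nat) (u_ a : nat -> R) (x s : nat -> R) (U : R -> R).
Hypothesis P : melting_profile m n u_ a x s U.

Let hu01 : u_ 0%N <= u_ 1%N. Proof. exact: (mp_temp01 P). Qed.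
Let hu i : (1 <= i < m)%N -> u_ i < u_ i.+1. Proof. exact: (mp_temp P). Qed.
Let a0 i : (i <= m)%N -> 0 < a i. Proof. exact: (mp_diff_gt0 P). Qed.
Let nm : (n <= m)%N. Proof. exact: (mp_type P). Qed.
Let xlast : x n.+1 = 0. Proof. exact: (mp_boundary P). Qed.
Let xd i : (1 <= i <= n)%N -> x i.+1 < x i. Proof. exact: (mp_lines P). Qed.
Let UE i z : (i <= n)%N -> zone x i z ->
  U z = u_ i + s i * (top a x i - Phi (a i) z).
Proof. exact: (mp_zone P). Qed.
Let UL i : (1 <= i <= n)%N -> U (x i) = u_ i. Proof. exact: (mp_line P). Qed.
Let s_gap i : (i < n)%N -> s i * gap a x i = u_ i.+1 - u_ i.
Proof. exact: (mp_slope P). Qed.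
Let s_last : 0 < s n. Proof. exact: (mp_slope_last P). Qed.
Let s_top : (n < m)%N -> s n * top a x n <= u_ n.+1 - u_ n.
Proof. exact: (mp_slope_top P). Qed.
Local Notation zone := (zone x).

Lemma profile_lines : lines x n.+1.
Proof. by split; [move=> i ni; apply: xd; lia|rewrite xlast]. Qed.

Lemma profile_line_ge0 i : (i <= n)%N -> 0 <= x i.+1.
Proof. by move=> ni; apply: (lines_ge0 profile_lines); lia. Qed.

Lemma profile_line_gt0 i : (1 <= i <= n)%N -> 0 < x i.
Proof.
by move=> ni; apply: (@le_lt_trans _ _ (x i.+1)); [apply: profile_line_ge0; lia|apply: xd; lia].
Qed.

Lemma zone_gt0 i z : (i <= n)%N -> zone i z -> 0 < z.
Proof. by move=> ni [xz _]; exact: le_lt_trans (profile_line_ge0 ni) xz. Qed.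

(** The first line below z has number i + 1. *)
Lemma zone_cover z : 0 < z -> exists i,
  [/\ (i <= n)%N, x i.+1 < z & i = 0%N \/ z <= x i].
Proof.
move=> z0.
have ex : exists i, x i.+1 < z by exists n; rewrite xlast.
case: (ex_minnP ex) => i xi min_i.
exists i; split => //; first by apply: min_i; rewrite xlast.
case: i xi min_i => [|i] xi min_i; [by left|right].
by rewrite leNgt; apply/negP => /min_i; lia.
Qed.

Lemma zone_or_line z : 0 < z -> exists2 i, (i <= n)%N &
  zone i z \/ (0 < i)%N /\ z = x i.
Proof.
move=> z0; have [i [ni xz zx]] := zone_cover z0; exists i => //.
case: zx => [i0|]; first by left; split => //; left.
rewrite le_eqVlt => /predU1P[e|zx]; last by left; split => //; right.
by have [i0|i0] := posnP i; [left; split => //; left|right].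
Qed.

Lemma zone_gap_gt0 i : (i < n)%N -> 0 < gap a x i.
Proof.
move=> ni; have c0 : 0 < a i by apply: a0; lia.
rewrite subr_gt0 /top; case: eqP => [_|i0]; first exact: Phi_lt1.
by apply: Phi_lt => //; apply: xd; lia.
Qed.

Lemma zone_top z i : (i <= n)%N -> zone i z -> 0 < top a x i - Phi (a i) z.
Proof.
move=> ni [_ zx]; rewrite subr_gt0 /top.
case: zx => [->|zx]; first by rewrite eqxx Phi_lt1.
by case: eqP => [_|i0]; [exact: Phi_lt1|apply: Phi_lt => //; apply: a0; lia].
Qed.

(** Phase 0 is flat when u_0 = u_1; every other phase is strictly monotone. *)
Lemma slope_gt0_or_degenerate i : (i <= n)%N -> 0 < s i \/ [/\ i = 0%N, u_ 0 = u_ 1 & s 0 = 0].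
Proof.
rewrite leq_eqVlt => /predU1P[->|ni]; first by left.
have g0 := zone_gap_gt0 ni; have e := s_gap ni.
have : u_ i <= u_ i.+1 by apply: (temp_le hu hu01); lia.
rewrite le_eqVlt => /predU1P[eu|lu].
  right; case: i ni g0 e eu => [|i] ni g0 e eu.
    split => //; move: e; rewrite eu subrr => /eqP; rewrite mulf_eq0.
    by rewrite [gap _ _ _ == 0]gt_eqF// orbF => /eqP.
  by have := hu (i := i.+1) ltac:(lia); rewrite eu ltxx.
by left; rewrite -(pmulr_lgt0 _ g0) e subr_gt0.
Qed.

Lemma zone_phase_domain i z : (i <= n)%N -> 0 < s i -> zone i z ->
  phase_domain m u_ i (U z).
Proof.
move=> ni si zi; have im : (i <= m)%N by lia.
have tz := zone_top ni zi; have c0 := a0 im.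
apply/phase_domainP => //; rewrite (UE ni zi).
split; first by rewrite ltrDl mulr_gt0.
move=> im'; rewrite addrC -ltrBrDr.
case: zi => [xz _]; move: ni; rewrite leq_eqVlt => /predU1P[e|ni].
  subst i; apply: (lt_le_trans _ (s_top im')); rewrite ltr_pM2l//.
  by rewrite ltrBlDr ltrDl -(Phi0 (a n)) Phi_lt// -xlast.
by rewrite -s_gap// ltr_pM2l// ltrD2l ltrN2 Phi_lt.
Qed.

Lemma zone_in_phase i z : (i <= n)%N -> zone i z -> in_phase m u_ i (U z).
Proof.
move=> ni zi; have [si|[i0 eu s0]] := slope_gt0_or_degenerate ni.
  by left; exact: zone_phase_domain.
right; split => //; rewrite (UE ni zi); subst i.
by rewrite s0 mul0r addr0.
Qed.

Lemma zone_left i z : x i.+1 < z -> (i = 0%N \/ z <= x i) ->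
  \forall y \near z^'-, zone i y.
Proof.
move=> xz [i0|zx]; near=> y; split.
- by near: y; exact: nbhs_left_gt.
- by left.
- by near: y; exact: nbhs_left_gt.
- by right; apply: lt_le_trans zx; near: y; exact: nbhs_left_lt.
Unshelve. all: by end_near. Qed.

Lemma zone_right i z : x i.+1 <= z -> (i = 0%N \/ z < x i) ->
  \forall y \near z^'+, zone i y.
Proof.
move=> xz [i0|zx]; near=> y; split.
- by apply: (le_lt_trans xz); near: y; exact: nbhs_right_gt.
- by left.
- by apply: (le_lt_trans xz); near: y; exact: nbhs_right_gt.
- by right; near: y; exact: nbhs_right_lt.
Unshelve. all: by end_near. Qed.

Lemma zone_near i z : zone i z -> \forall y \near z, zone i y.
Proof.
move=> [xz [i0|zx]]; near=> y; split.
- by near: y; exact: lt_nbhsr.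
- by left.
- by near: y; exact: lt_nbhsr.
- by right; near: y; exact: lt_nbhsl.
Unshelve. all: by end_near. Qed.

(** The temperature ranges are disjoint, so the range that contains the value at z
    identifies the zone of z. *)
Lemma profile_phase_zone i z : (i <= m)%N -> 0 < z ->
  phase_domain m u_ i (U z) -> (i <= n)%N /\ zone i z.
Proof.
move=> im z0 pd; have [j jn [zj|[j0 e]]] := zone_or_line z0.
  have jm : (j <= m)%N by lia.
  by rewrite (phase_domain_unique hu hu01 im jm pd (zone_in_phase jn zj)).
exfalso; move: pd; rewrite e UL; last lia.
by apply: (phase_domain_line hu hu01 _ im); lia.
Qed.

Definition zone_formula i z := u_ i + s i * (top a x i - Phi (a i) z).

Lemma zone_formula_cont i z : {for z, continuous (zone_formula i)}.
Proof.
apply: cvgD; first exact: cvg_cst.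
apply: cvgMr; apply: cvgB; first exact: cvg_cst.
exact: der_cont (der_Phi _ _).
Qed.

Lemma profile_cvg_left i z : (i <= n)%N -> x i.+1 < z -> (i = 0%N \/ z <= x i) ->
  U y @[y --> z^'-] --> zone_formula i z.
Proof.
move=> ni xz zx.
apply: (@cvg_near_eq _ _ _ _ _ (zone_formula i)).
  by apply: filterS (zone_left xz zx) => y /(UE ni) ->.
exact/cvg_at_left_filter/zone_formula_cont.
Qed.

Lemma profile_cvg_right i z : (i <= n)%N -> x i.+1 <= z -> (i = 0%N \/ z < x i) ->
  U y @[y --> z^'+] --> zone_formula i z.
Proof.
move=> ni xz zx.
apply: (@cvg_near_eq _ _ _ _ _ (zone_formula i)).
  by apply: filterS (zone_right xz zx) => y /(UE ni) ->.
exact/cvg_at_right_filter/zone_formula_cont.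
Qed.

Lemma formula_line_warm i : (1 <= i <= n)%N -> zone_formula i (x i) = u_ i.
Proof.
move=> ni; rewrite /zone_formula /top; case: eqP => [|_]; first lia.
by rewrite subrr mulr0 addr0.
Qed.

Lemma formula_line_cold i : (i < n)%N -> zone_formula i (x i.+1) = u_ i.+1.
Proof. by move=> ni; rewrite /zone_formula -/(gap a x i) s_gap// addrC subrK. Qed.

Lemma profile_continuous z : 0 < z -> {for z, continuous U}.
Proof.
move=> z0; have [i ni [zi|[i0 ze]]] := zone_or_line z0; last first.
- apply/left_right_continuousP; rewrite ze UL; last lia.
  have i1 : (i.-1 < n)%N by lia.
  split.
    rewrite -[X in _ --> X]formula_line_warm; last lia.
    by apply: profile_cvg_left => //; [apply: xd; lia|right].
  have := formula_line_cold i1; rewrite prednK// => <-.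
  apply: profile_cvg_right; [lia|by rewrite prednK|].
  have [->|p0] := eqVneq i.-1 0%N; [by left|right].
  by have := xd (i := i.-1); rewrite prednK//; apply; lia.
- rewrite -[{for z, continuous U}]/(U y @[y --> z] --> U z) (UE ni zi).
  apply: (@cvg_near_eq _ _ _ _ _ (zone_formula i)).
    by apply: filterS (zone_near zi) => y /(UE ni) ->.
  exact: zone_formula_cont.
Qed.

Lemma profile_ge z : 0 < z -> u_ 0 <= U z.
Proof.
move=> z0; have [i ni [zi|[i0 ze]]] := zone_or_line z0; last first.
- by rewrite ze UL; [apply: (temp_le hu hu01); lia|lia].
- have im : (i <= m)%N by lia.
  have u0i : u_ 0 <= u_ i by apply: (temp_le hu hu01); lia.
  case: (zone_in_phase ni zi) => [/(phase_domainP _ _ im)[ui _]|[_ _ ->]//].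
  exact/ltW/(le_lt_trans u0i).
Qed.

Lemma profile_cvg_pinfty : U z @[z --> +oo] --> u_ 0.
Proof.
have c0 : 0 < a 0 by apply: a0.
have -> : u_ 0 = u_ 0 + s 0 * (1 - 1) by rewrite subrr mulr0 addr0.
have h : u_ 0 + s 0 * (1 - Phi (a 0) z) @[z --> +oo] --> u_ 0 + s 0 * (1 - 1).
  apply: cvgD; first exact: cvg_cst.
  apply: cvgMr; apply: cvgB; first exact: cvg_cst.
  exact: Phi_cvg.
apply: cvg_near_eq h; near=> z.
rewrite (@UE 0)//; split; last by left.
by near: z; exact: nbhs_pinfty_gt (num_real _).
Unshelve. all: by end_near. Qed.

End Profile.

(** * The function of time and space generated by a profile *)

Lemma der_derive1 {R : realType} (f : R -> R) (x d : R) :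
  is_derive x 1 f d -> derive1 f x = d.
Proof. by move=> df; rewrite derive1E; case: df. Qed.

Section Evolution.
Context {R : realType}.
Variables (m n : nat) (u_ a : nat -> R) (x s : nat -> R) (U : R -> R).
Hypothesis P : melting_profile m n u_ a x s U.
Variable v : R -> R -> R.
Hypothesis hv : forall t y : R, 0 < t -> 0 < y -> v t y = U (y / Num.sqrt t).

Let nm : (n <= m)%N. Proof. exact: (mp_type P). Qed.
Let a0 i : (i <= m)%N -> 0 < a i. Proof. exact: (mp_diff_gt0 P). Qed.
Let hu01 : u_ 0%N <= u_ 1%N. Proof. exact: (mp_temp01 P). Qed.
Let hu i : (1 <= i < m)%N -> u_ i < u_ i.+1. Proof. exact: (mp_temp P). Qed.

(** An open set of the (t, x)-plane, on which the function is given by one explicit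
    formula; derivatives can therefore be computed from it. *)
Definition in_sector i (p : R * R) := 0 < p.1 /\ zone x i (p.2 / Num.sqrt p.1).

Lemma in_sector_near i p : in_sector i p -> \forall q \near p, in_sector i q.
Proof.
move=> [p0 zp].
have h1 : \forall q \near p, 0 < q.1.
  have f : (fun q : R * R => q.1) @ p --> p.1 by exact: cvg_fst.
  exact: (f _ (lt_nbhsr p0)).
have h2 : \forall q \near p, zone x i (q.2 / Num.sqrt q.1).
  exact: (cvg_ratio p0 (zone_near zp)).
by apply: filterS2 h1 h2 => q; split.
Qed.

Lemma near_pair_l (t y : R) (Q : R * R -> Prop) :
  (\forall q \near (t, y), Q q) -> \forall z \near t, Q (z, y).
Proof.
exact: (@cvg_pair R R R (nbhs t) (nbhs t) (nbhs y) _ _ _ id (fun=> y) cvg_id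
  (cvg_cst y) Q).
Qed.

Lemma near_pair_r (t y : R) (Q : R * R -> Prop) :
  (\forall q \near (t, y), Q q) -> \forall z \near y, Q (t, z).
Proof.
exact: (@cvg_pair R R R (nbhs y) (nbhs t) (nbhs y) _ _ _ (fun=> t) id
  (cvg_cst t) cvg_id Q).
Qed.

Lemma in_sector_gt0 i p : (i <= n)%N -> in_sector i p -> 0 < p.2.
Proof.
move=> ni [p0 /(zone_gt0 P ni)]; rewrite pmulr_lgt0// invr_gt0 sqrtr_gt0//.
Qed.

Definition sector_level i := u_ i + s i * top a x i.

Lemma sectorE i p : (i <= n)%N -> in_sector i p ->
  v p.1 p.2 = selfsim (a i) (sector_level i) (s i) p.1 p.2.
Proof.
move=> ni ip; rewrite hv; [|exact: ip.1|exact: in_sector_gt0 ip].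
rewrite (mp_zone P ni ip.2) /selfsim /sector_level; ring.
Qed.

Section InSector.
Variables (i : nat).
Hypothesis ni : (i <= n)%N.

Let c0 : 0 < a i. Proof. by apply: a0; apply: leq_trans nm. Qed.

Lemma sector_dx t y : in_sector i (t, y) ->
  is_derive y 1 (v t) (selfsim_x (a i) (s i) t y).
Proof.
move=> ip; apply: near_eq_is_derive (der_selfsim_x (a i) (sector_level i) (s i) t y).
have := near_pair_r (in_sector_near ip).
by apply: filterS => z /(sectorE ni)/= ->.
Qed.

Lemma sector_dt t y : in_sector i (t, y) ->
  is_derive t 1 (v ^~ y) (selfsim_t (a i) (s i) t y).
Proof.
move=> ip; apply: near_eq_is_derive (der_selfsim_t (a i) (sector_level i) (s i) y ip.1).
have := near_pair_l (in_sector_near ip).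
by apply: filterS => z /(sectorE ni)/= ->.
Qed.

Lemma sector_dxx t y : in_sector i (t, y) ->
  is_derive y 1 (derive1 (v t)) (selfsim_xx (a i) (s i) t y).
Proof.
move=> ip; apply: near_eq_is_derive (der_selfsim_xx (s i) y c0 ip.1).
have := near_pair_r (in_sector_near ip).
by apply: filterS => z /sector_dx/der_derive1 ->.
Qed.

Lemma sector_heat t y : in_sector i (t, y) -> heat_equation v (a i) t y.
Proof.
move=> ip; have dt := sector_dt ip; have dx := sector_dx ip; have dxx := sector_dxx ip.
split; [by case: dt|by case: dx|by case: dxx|].
rewrite (der_derive1 dt) derive1nS derive1n1 (der_derive1 dxx).
exact: selfsim_heat c0 ip.1.
Qed.

Lemma sector_smooth t y : in_sector i (t, y) -> smooth_at v t y.
Proof.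
move=> ip; have nip := in_sector_near ip; have t0 : 0 < (t, y).1 := ip.1.
have tr (f g : R * R -> R) : (forall q, in_sector i q -> f q = g q) ->
    {for (t, y), continuous g} -> {for (t, y), continuous f}.
  move=> fg cg; rewrite -[{for _, continuous f}]/(f q @[q --> (t, y)] --> f (t, y)) fg//.
  by apply: cvg_near_eq cg; apply: filterS nip => q; exact: fg.
split.
- apply: (tr (fun p => derive1 (v ^~ p.2) p.1)
    (fun p => selfsim_t (a i) (s i) p.1 p.2)); last exact: continuous_selfsim_t.
  by move=> -[t' y'] /sector_dt/der_derive1.
- apply: (tr (fun p => derive1 (v p.1) p.2)
    (fun p => selfsim_x (a i) (s i) p.1 p.2)); last exact: continuous_selfsim_x.
  by move=> -[t' y'] /sector_dx/der_derive1.
- apply: (tr (fun p => derive1n 2 (v p.1) p.2)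
    (fun p => selfsim_xx (a i) (s i) p.1 p.2)); last exact: continuous_selfsim_xx.
  by move=> -[t' y'] /sector_dxx/der_derive1.
Qed.

Lemma selfsim_x_cont (c B t y : R) : {for y, continuous (selfsim_x c B t)}.
Proof.
apply: cvgN; apply: cvgMl; apply: cvgMr.
apply: (cvg_comp _ _ (der_cont (der_divr (Num.sqrt t) y))).
exact: der_cont (der_phi c _).
Qed.

Lemma sector_left t y : 0 < t -> x i.+1 < y / Num.sqrt t ->
  (i = 0%N \/ y / Num.sqrt t <= x i) ->
  \forall z \near y^'-, in_sector i (t, z).
Proof.
move=> t0 yx yx'; have st : 0 < Num.sqrt t by rewrite sqrtr_gt0.
rewrite ltr_pdivlMr// in yx; rewrite ler_pdivrMr// in yx'.
near=> z; split=> //=; split.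
  by rewrite ltr_pdivlMr//; near: z; exact: nbhs_left_gt.
case: yx' => [|h]; [by left|right; rewrite ltr_pdivrMr//].
by apply: lt_le_trans h; near: z; exact: nbhs_left_lt.
Unshelve. all: by end_near. Qed.

Lemma sector_right t y : 0 < t -> x i.+1 <= y / Num.sqrt t ->
  (i = 0%N \/ y / Num.sqrt t < x i) ->
  \forall z \near y^'+, in_sector i (t, z).
Proof.
move=> t0 yx yx'; have st : 0 < Num.sqrt t by rewrite sqrtr_gt0.
rewrite ler_pdivlMr// in yx; rewrite ltr_pdivrMr// in yx'.
case: yx' => h; near=> z; (split=> //=; split).
- rewrite ltr_pdivlMr//; apply: (le_lt_trans yx); near: z; exact: nbhs_right_gt.
- by left.
- rewrite ltr_pdivlMr//; apply: (le_lt_trans yx); near: z; exact: nbhs_right_gt.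
- right; rewrite ltr_pdivrMr//; near: z; exact: nbhs_right_lt.
Unshelve. all: by end_near. Qed.

Lemma flux_left t y : 0 < t -> x i.+1 < y / Num.sqrt t ->
  (i = 0%N \/ y / Num.sqrt t <= x i) ->
  derive1 (v t) z @[z --> y^'-] --> selfsim_x (a i) (s i) t y.
Proof.
move=> t0 h1 h2; apply: (@cvg_near_eq _ _ _ _ _ (selfsim_x (a i) (s i) t)).
  by apply: filterS (sector_left t0 h1 h2) => z /sector_dx/der_derive1.
exact/cvg_at_left_filter/selfsim_x_cont.
Qed.

Lemma flux_right t y : 0 < t -> x i.+1 <= y / Num.sqrt t ->
  (i = 0%N \/ y / Num.sqrt t < x i) ->
  derive1 (v t) z @[z --> y^'+] --> selfsim_x (a i) (s i) t y.
Proof.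
move=> t0 h1 h2; apply: (@cvg_near_eq _ _ _ _ _ (selfsim_x (a i) (s i) t)).
  by apply: filterS (sector_right t0 h1 h2) => z /sector_dx/der_derive1.
exact/cvg_at_right_filter/selfsim_x_cont.
Qed.

Lemma sector_in_phase p : in_sector i p -> in_phase m u_ i (v p.1 p.2).
Proof.
move=> ip; rewrite hv; [|exact: ip.1|exact: in_sector_gt0 ip].
exact: (zone_in_phase P ni ip.2).
Qed.

End InSector.

End Evolution.

(** * Stefan conditions and flux balance *)

Section Balance.
Context {R : realType}.
Variables (m n : nat) (u_ a k d : nat -> R) (x s : nat -> R) (U : R -> R).
Variables (alpha : R -> R) (bN : R).
Hypothesis P : melting_profile m n u_ a x s U.
Variable v : R -> R -> R.
Hypothesis hv : forall t y : R, 0 < t -> 0 < y -> v t y = U (y / Num.sqrt t).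

Let nm : (n <= m)%N. Proof. exact: (mp_type P). Qed.
Let a0 i : (i <= m)%N -> 0 < a i. Proof. exact: (mp_diff_gt0 P). Qed.
Let hu01 : u_ 0%N <= u_ 1%N. Proof. exact: (mp_temp01 P). Qed.
Let hu i : (1 <= i < m)%N -> u_ i < u_ i.+1. Proof. exact: (mp_temp P). Qed.
Let xd i : (1 <= i <= n)%N -> x i.+1 < x i. Proof. exact: (mp_lines P). Qed.

(** What the Stefan condition says on the line x = x_i sqrt t, after multiplication
    by sqrt t. *)
Definition flux_balance i :=
  d i * x i / 2 - k i * s i * phi (a i) (x i)
  + k i.-1 * s i.-1 * phi (a i.-1) (x i) = 0.

Lemma der_parabola (c t : R) : 0 < t -> is_derive t 1 (fun t : R => c * Num.sqrt t)
  (c / (2 * Num.sqrt t)).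
Proof. by move=> t0; exact: (derZ c (is_derive1_sqrt t0)). Qed.

Lemma parabola_ratio (c t : R) : 0 < t -> c * Num.sqrt t / Num.sqrt t = c.
Proof. by move=> t0; rewrite mulfK// gt_eqF// sqrtr_gt0. Qed.

Lemma line_flux_warm i t : (1 <= i <= n)%N -> 0 < t ->
  derive1 (v t) z @[z --> (x i * Num.sqrt t)^'-] -->
    - (s i * phi (a i) (x i) / Num.sqrt t).
Proof.
move=> ni t0; have := @flux_left _ _ _ _ _ _ _ _ P v hv i _ t (x i * Num.sqrt t) t0.
rewrite /selfsim_x !parabola_ratio//; apply; [lia|exact: xd|by right].
Qed.

Lemma line_flux_cold i t : (1 <= i <= n)%N -> 0 < t ->
  derive1 (v t) z @[z --> (x i * Num.sqrt t)^'+] -->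
    - (s i.-1 * phi (a i.-1) (x i) / Num.sqrt t).
Proof.
move=> ni t0; have := @flux_right _ _ _ _ _ _ _ _ P v hv i.-1 _ t (x i * Num.sqrt t) t0.
rewrite /selfsim_x !parabola_ratio// prednK; last lia.
apply; [lia|by []|].
have [->|i0] := eqVneq i.-1 0%N; [by left|right].
by have := xd (i := i.-1); rewrite prednK; [apply; lia|lia].
Qed.

Lemma line_transition i t1 t2 : (1 <= i <= n)%N -> 0 <= t1 ->
  phase_transition_line m u_ v i true t1 t2 (fun t => x i * Num.sqrt t).
Proof.
move=> ni t10; split => // t /andP[t1t tt2].
have t0 : 0 < t by exact: le_lt_trans t1t.
have st : 0 < Num.sqrt t by rewrite sqrtr_gt0.
have X0 : 0 < x i * Num.sqrt t by rewrite mulr_gt0 ?(profile_line_gt0 P).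
split => //.
- exact: der_cont (der_parabola _ t0).
- by rewrite hv// parabola_ratio// (mp_line P).
- have im : (i <= n)%N by lia.
  have := @sector_left _ x i t (x i * Num.sqrt t) t0.
  rewrite parabola_ratio// => /(_ (xd ni) (or_intror (lexx _))).
  by apply: filterS => z /(sector_in_phase P hv im).
- have im : (i.-1 <= n)%N by lia.
  have := @sector_right _ x i.-1 t (x i * Num.sqrt t) t0.
  rewrite parabola_ratio// prednK; last lia.
  move=> /(_ (lexx _)) h; have {}h : \forall z \near (x i * Num.sqrt t)^'+,
      in_sector x i.-1 (t, z).
    apply: h; have [->|i0] := eqVneq i.-1 0%N; [by left|right].
    by have := xd (i := i.-1); rewrite prednK; [apply; lia|lia].
  by apply: filterS h => z /(sector_in_phase P hv im).
Qed.

(** The curves x_i sqrt t are transition lines with the warmer phase on the left;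
    the condition at t = 1 is the flux balance. *)
Lemma balance_of_solution : stefan_neumann_solution m u_ a k d alpha bN v ->
  forall i, (1 <= i <= n)%N -> flux_balance i.
Proof.
move=> sol i ni.
have t01 : 0 < (1 : R) < 2 by rewrite ltr01 ltr1n.
have [_ [uw [uc [hw hc e]]]] := sn_stefan sol (i := i) ltac:(lia)
  (line_transition 2 ni (lexx 0)) t01.
rewrite /side /= in hw hc.
have ew := cvg_unique (@Rhausdorff R) hw (line_flux_warm ni ltr01).
have ec := cvg_unique (@Rhausdorff R) hc (line_flux_cold ni ltr01).
rewrite (der_derive1 (der_parabola _ ltr01)) sqrtr1 in e.
rewrite sqrtr1 !divr1 in ew ec.
by rewrite /flux_balance -[RHS]e ew ec; field.
Qed.

(** There are no other transition lines: near X t the phase on the warm side is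
    phase i, while the profile decreases through its phases from left to right. *)
Lemma line_is_transition i wl t1 t2 X t : (1 <= i <= m)%N ->
  phase_transition_line m u_ v i wl t1 t2 X -> t1 < t < t2 ->
  [/\ 0 < t, wl, (i <= n)%N & X t = x i * Num.sqrt t].
Proof.
move=> im [t10 /(_ t)] h t12; have {h}[X0 _ vX ww _] := h t12.
have t0 : 0 < t by case/andP: t12 => t1t _; exact: le_lt_trans t1t.
have st : 0 < Num.sqrt t by rewrite sqrtr_gt0.
set z := X t / Num.sqrt t.
have z0 : 0 < z by rewrite divr_gt0.
have Uz : U z = u_ i by rewrite -hv.
(* X t is not inside a zone, where the value u_ i is not taken. *)
have notz j : (j <= n)%N -> zone x j z -> i <> j.
  move=> jn zj ij; subst j; have := zone_in_phase P jn zj.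
  rewrite Uz => /in_phaseS pd; have {}pd := pd ltac:(lia).
  by move: pd; apply: (phase_domain_line hu hu01); lia.
(* The zone that touches X t on the warm side has number i. *)
have sd j : (j <= n)%N -> (\forall y \near side wl (X t), in_sector x j (t, y)) -> i = j.
  move=> jn hj.
  have PF : ProperFilter (side wl (X t)) by rewrite /side; case: wl {hj ww}; exact: _.
  have [y [iy jy]] := filter_ex (filterI ww hj).
  have i1 : (1 <= i)%N by lia.
  have jm : (j <= m)%N by lia.
  have im' : (i <= m)%N by lia.
  exact: (phase_domain_unique hu hu01 im' jm (in_phaseS i1 iy)
    (sector_in_phase P hv jn jy)).
have [j jn [zj|[j0 zxj]]] := zone_or_line P z0.
  exfalso; apply: (notz j jn zj); apply: sd => //.
  case: zj => [xz zx]; rewrite /side; case: wl {ww}.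
    by apply: sector_left => //; case: zx => [|/ltW]; [left|right].
  by apply: sector_right => //; exact: ltW.
have xj : x j.+1 < z by rewrite zxj xd//; lia.
case: wl ww sd => ww sd.
  have ij : i = j by apply: sd => //; apply: sector_left => //; right; rewrite -/z zxj.
  by rewrite ij; split => //; rewrite -zxj /z divfK// gt_eqF.
exfalso.
(* With the warmer phase on the right, X t would be on line i + 1 as well as at
   temperature u_ i. *)
have ij : i = j.-1.
  apply: sd; first lia.
  apply: sector_right => //; first by rewrite prednK// -/z zxj.
  have [->|j1] := eqVneq j.-1 0%N; [by left|right; rewrite -/z zxj].
  by have := xd (i := j.-1); rewrite prednK//; apply; lia.
have : u_ i < u_ j by apply: (temp_lt hu); lia.
by rewrite -Uz zxj (mp_line P) ?ltxx//; lia.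
Qed.

Hypothesis halpha : is_alpha m u_ k alpha.
Hypothesis balance : forall i, (1 <= i <= n)%N -> flux_balance i.
Hypothesis boundary : k n * (s n * phi (a n) 0) = - bN.

Lemma stefan_of_balance i wl t1 t2 X : (1 <= i <= m)%N ->
  phase_transition_line m u_ v i wl t1 t2 X ->
  forall t, t1 < t < t2 -> stefan_condition k d v i wl X t.
Proof.
move=> im tr t t12.
have [t0 wlT ni Xt] := line_is_transition im tr t12.
have ni' : (1 <= i <= n)%N by lia.
have dX : is_derive t 1 X (x i / (2 * Num.sqrt t)).
  apply: near_eq_is_derive (der_parabola (x i) t0).
  have [t1t tt2] := andP t12.
  near=> r; have [|_ _ _ ->//] := line_is_transition im tr (t := r).
  by apply/andP; split; near: r; [exact: lt_nbhsr|exact: lt_nbhsl].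
split; first by case: dX.
rewrite /side wlT /= Xt.
exists (- (s i * phi (a i) (x i) / Num.sqrt t)),
  (- (s i.-1 * phi (a i.-1) (x i) / Num.sqrt t)).
split; [exact: line_flux_warm|exact: line_flux_cold|].
rewrite (der_derive1 dX).
have st : Num.sqrt t != 0 by rewrite gt_eqF// sqrtr_gt0.
transitivity ((d i * x i / 2 - k i * s i * phi (a i) (x i)
  + k i.-1 * s i.-1 * phi (a i.-1) (x i)) / Num.sqrt t); first by field.
by rewrite balance// mul0r.
Unshelve. all: by end_near. Qed.

(** As t -> 0 with x near y > 0 the similarity variable x / sqrt t tends to
    +oo. *)
Lemma initial_limit y : 0 < y ->
  v p.1 p.2 @[p --> within [set p : R * R | 0 < p.1] (nbhs ((0, y) : R * R))]
      --> u_ 0.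
Proof.
move=> y0; set G := within _ _.
have lim A : \forall p \near G, A <= p.2 / Num.sqrt p.1.
  have f : (fun p : R * R => p.2 - A * Num.sqrt p.1) @ ((0, y) : R * R) --> y - A * Num.sqrt 0.
    apply: cvgB; first exact: cvg_snd.
    by apply: cvgMr; exact: (@cvg_sqrt_fst _ (0, y)).
  rewrite sqrtr0 mulr0 subr0 in f.
  have f0 : \forall p \near ((0, y) : R * R), 0 < p.2 - A * Num.sqrt p.1.
    exact: (f _ (lt_nbhsr y0)).
  rewrite /G near_withinE; apply: filterS f0 => p /= h p0.
  by rewrite ler_pdivlMr ?sqrtr_gt0//; apply/ltW; rewrite -subr_gt0.
have cr : (fun p : R * R => p.2 / Num.sqrt p.1) @ G --> +oo by apply/cvgryPge.
apply: (@cvg_near_eq _ _ _ _ _ (fun p => U (p.2 / Num.sqrt p.1))); last first.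
  exact: (cvg_comp _ _ cr (profile_cvg_pinfty P)).
have f : (fun p : R * R => p.2) @ ((0, y) : R * R) --> y by exact: cvg_snd.
have f0 : \forall p \near ((0, y) : R * R), 0 < p.2 by exact: (f _ (lt_nbhsr y0)).
by rewrite /G near_withinE; apply: filterS f0 => p /= h p0; rewrite hv.
Qed.

Lemma boundary_zone t : 0 < t -> \forall y \near 0^'+, in_sector x n (t, y).
Proof.
move=> t0; apply: sector_right => //; rewrite mul0r ?(mp_boundary P)//.
by have [|n0] := posnP n; [left|right; apply: (profile_line_gt0 P); lia].
Qed.

(** Near the boundary the values stay in the range of phase n, where alpha is
    affine with slope k_n. *)
Lemma boundary_der t y : in_sector x n (t, y) ->
  is_derive y 1 (alpha \o v t) (k n * selfsim_x (a n) (s n) t y).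
Proof.
move=> iy; have [_ al] := halpha.
have pd z : in_sector x n (t, z) -> phase_domain m u_ n (v t z).
  move=> iz; rewrite hv; [|exact: iz.1|exact: (in_sector_gt0 P (leqnn n) iz)].
  exact: (zone_phase_domain P (leqnn n) (mp_slope_last P) iz.2).
have dv := sector_dx P hv (leqnn n) iy.
have := derD (der_cst (alpha (v t y) - k n * v t y) y) (derZ (k n) dv).
rewrite add0r; apply: near_eq_is_derive.
have := near_pair_r (in_sector_near iy); apply: filterS => z iz /=.
by have := al n _ _ nm (pd z iz) (pd y iy); lra.
Qed.

Lemma solution_of_balance : stefan_neumann_solution m u_ a k d alpha bN v.
Proof.
split.
- by move=> t y t0 y0; rewrite hv//; apply: (profile_ge P); rewrite divr_gt0 ?sqrtr_gt0.
- move=> t y t0 y0; have z0 : 0 < y / Num.sqrt t by rewrite divr_gt0 ?sqrtr_gt0.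
  rewrite -[{for _, continuous _}]/(v p.1 p.2 @[p --> (t, y)] --> v t y) hv//.
  apply: (@cvg_near_eq _ _ _ _ _ (fun p => U (p.2 / Num.sqrt p.1))); last first.
    by apply: (cvg_comp _ _ (@cvg_ratio _ (t, y) t0)); exact: (profile_continuous P z0).
  have f1 : (fun p : R * R => p.1) @ (t, y) --> t by exact: cvg_fst.
  have f2 : (fun p : R * R => p.2) @ (t, y) --> y by exact: cvg_snd.
  have h1 : \forall p \near (t, y), 0 < p.1 by exact: (f1 _ (lt_nbhsr t0)).
  have h2 : \forall p \near (t, y), 0 < p.2 by exact: (f2 _ (lt_nbhsr y0)).
  by apply: filterS2 h1 h2 => p p1 p2; exact: hv.
- move=> t y t0 y0 B nB; have z0 : 0 < y / Num.sqrt t by rewrite divr_gt0 ?sqrtr_gt0.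
  have [i [ni xz zx]] := zone_cover P z0.
  have h1 := sector_left t0 xz zx.
  have h2 : \forall z \near y^'-, B (t, z).
    have := near_pair_r nB; apply: cvg_within.
  have [z [iz Bz]] := @filter_ex _ _ (at_left_proper_filter y) _ (filterI h1 h2).
  exists (t, z); split => //; split => //; first exact: (in_sector_gt0 P ni iz).
  exists i; first exact: leq_trans ni nm.
  exact: (sector_in_phase P hv ni iz).
- move=> i t y im t0 y0; have z0 : 0 < y / Num.sqrt t by rewrite divr_gt0 ?sqrtr_gt0.
  rewrite hv// => /(profile_phase_zone P im z0)[ni zi].
  have iy : in_sector x i (t, y) by split.
  by split; [exact: (sector_heat P hv ni)|exact: (sector_smooth P hv ni)].
- exact: stefan_of_balance.
- exact: initial_limit.
- move=> t t0; split.
    by apply: filterS (boundary_zone t0) => y /boundary_der[].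
  apply: (@cvg_near_eq _ _ _ _ _ (fun y => k n * selfsim_x (a n) (s n) t y)).
    by apply: filterS (boundary_zone t0) => y /boundary_der/der_derive1.
  have -> : bN / Num.sqrt t = k n * selfsim_x (a n) (s n) t 0.
    rewrite /selfsim_x mul0r mulrN mulrA boundary.
    by rewrite mulNr opprK.
  apply: cvgMr; exact/cvg_at_right_filter/selfsim_x_cont.
Qed.

End Balance.

(** * Tuples of positions *)

Section Tuples.
Context {R : realType}.
Variable a : nat -> R.

(** The positions numbered from 1, with value 0 after the last one; there is no
    real value for x_0 = +oo, and 0 stands at index 0 so that two such functions
    are equal as soon as they agree on the lines. *)
Definition line_of (xi : seq R) (i : nat) : R :=
  if i is j.+1 then nth 0 xi j else 0.

Lemma xi_extS N (xi : N.-tuple R) i : xi_ext xi i.+1 = (line_of xi i.+1)%:E.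
Proof.
rewrite /xi_ext /=; have [iN|Ni] := ltnP i (size xi).
  by rewrite (nth_map 0).
by rewrite !nth_default// size_map.
Qed.

Lemma line_of_default N (xi : N.-tuple R) i : (N < i)%N -> line_of xi i = 0.
Proof. by case: i => // i Ni; rewrite /= nth_default// size_tuple. Qed.

Lemma xi_decreasingP N (xi : N.-tuple R) : xi_decreasing xi <->
  forall i, (1 <= i <= N)%N -> line_of xi i.+1 < line_of xi i.
Proof.
split=> h [|i] iN //; try lia.
- by have := h i.+1 ltac:(lia); rewrite !xi_extS lte_fin.
- by rewrite xi_extS ltry.
- by rewrite !xi_extS lte_fin; apply: h; lia.
Qed.

Lemma lines_line_of N (xi : N.-tuple R) : xi_decreasing xi ->
  lines (line_of xi) N.+1.
Proof.
move=> /xi_decreasingP h; split; last by rewrite line_of_default.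
by move=> i iN; apply: h; lia.
Qed.

Lemma line_of_ge0 N (xi : N.-tuple R) i : xi_decreasing xi -> 0 <= line_of xi i.
Proof.
move=> h; have [iN|Ni] := leqP i N; last by rewrite line_of_default.
by case: i iN => // i iN; apply: (lines_ge0 (lines_line_of h)); lia.
Qed.

Lemma FdivE c (z : R) : 0 < c -> 0 <= z -> Fdiv c z%:E = Phi c z.
Proof. by move=> c0 z0; rewrite Phi.unlock /= F_extE// divr_ge0// ltW. Qed.

Lemma Fdiv_top N (xi : N.-tuple R) i : 0 < a i -> xi_decreasing xi ->
  Fdiv (a i) (xi_ext xi i) = top a (line_of xi) i.
Proof.
case: i => [//|i] c0 h; rewrite xi_extS FdivE//; exact: line_of_ge0.
Qed.

Lemma zoneP N (xi : N.-tuple R) i (z : R) : zone (line_of xi) i z <->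
  (xi_ext xi i.+1 < z%:E)%E /\ (z%:E < xi_ext xi i)%E.
Proof.
rewrite xi_extS lte_fin; case: i => [|i].
  by split=> -[h1 h2]; split=> //; [rewrite ltry|left].
rewrite xi_extS lte_fin; split=> -[h1 h2]; split=> //; last by right.
by case: h2.
Qed.

End Tuples.

(** * Self-similar solutions and the numbers gamma *)

Record admissible {R : realType} (m : nat) (u_ a k d : nat -> R) : Prop := {
  adm_phases : (1 <= m)%N ;
  adm_temp01 : u_ 0%N <= u_ 1%N ;
  adm_temp : forall i, (1 <= i < m)%N -> u_ i < u_ i.+1 ;
  adm_diffusivity : forall i, (i <= m)%N -> 0 < a i ;
  adm_conductivity : forall i, (i <= m)%N -> 0 < k i ;
  adm_latent : forall i, (1 <= i <= m)%N -> 0 <= d i ;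
  adm_degenerate : u_ 0%N = u_ 1%N -> 0 < d 1%N }.

Section Problem.
Context {R : realType}.
Variables (m : nat) (u_ a k d : nat -> R) (alpha : R -> R) (bN : R).
Hypothesis H : admissible m u_ a k d.
Hypothesis halpha : is_alpha m u_ k alpha.
Hypothesis hbN : bN < 0.

Let b := - bN.
Let w i := k i * (u_ i.+1 - u_ i).

Let hm : (1 <= m)%N. Proof. exact: (adm_phases H). Qed.
Let hu01 : u_ 0%N <= u_ 1%N. Proof. exact: (adm_temp01 H). Qed.
Let hu i : (1 <= i < m)%N -> u_ i < u_ i.+1. Proof. exact: (adm_temp H). Qed.
Let ha i : (i <= m)%N -> 0 < a i. Proof. exact: (adm_diffusivity H). Qed.
Let hk i : (i <= m)%N -> 0 < k i. Proof. exact: (adm_conductivity H). Qed.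

Let b0 : 0 < b. Proof. by rewrite oppr_gt0. Qed.

Lemma admissible_shooting : shooting_data m a d w.
Proof.
split=> //; [exact: (adm_latent H)| | |].
- by rewrite mulr_ge0 ?subr_ge0// ltW// hk.
- by move=> i im; rewrite mulr_gt0 ?subr_gt0 ?hu ?hk//; lia.
- move=> /eqP; rewrite mulf_eq0 gt_eqF ?hk//= subr_eq0 => /eqP e.
  exact: (adm_degenerate H).
Qed.

Let S : shooting_data m a d w. Proof. exact: admissible_shooting. Qed.

Local Notation flux := (flux a d w).
Local Notation chain := (chain a d w).

Lemma dirichlet_energyE n (xi : n.-1.-tuple R) : (1 <= n <= m)%N ->
  xi_decreasing xi ->
  dirichlet_energy u_ a k d xi = energy a d w (line_of xi) n.
Proof.
move=> nm xid; rewrite /dirichlet_energy /energy; congr (- _ + _ * _).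
  apply: eq_big_nat => i /andP[_ ni].
  have c0 : 0 < a i by apply: ha; lia.
  by rewrite Fdiv_top// xi_extS FdivE//; exact: line_of_ge0.
apply: eq_big_nat => i ni.
by case: i ni => // i ni; rewrite xi_extS.
Qed.

Lemma chain_tuple n y : (1 <= n <= m)%N -> exists xi : n.-1.-tuple R,
  forall i, (1 <= i < n)%N -> line_of xi i = chain n y i.
Proof.
move=> nm; exists [tuple chain n y i.+1 | i < n.-1] => -[//|i] ni.
have i1 : (i < n.-1)%N by lia.
by rewrite /= (nth_map (Ordinal i1)) ?size_enum_ord// nth_enum_ord.
Qed.

(** The chain that ends at 0 is feasible and, by [energy_lt], strictly better than
    every other list; so the minimum point exists and is this chain. *)
Lemma min_point_chain n i : (1 <= n <= m)%N -> (1 <= i < n)%N ->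
  line_of (min_point u_ a k d n) i = chain n 0 i.
Proof.
move=> nm ni.
have [cl cs] := chain_system S nm (lexx 0).
have [xi exi] := chain_tuple 0 nm.
have cn : chain n 0 n = 0 by rewrite chain_last//; lia.
have lin (eta : n.-1.-tuple R) : xi_decreasing eta -> lines (line_of eta) n.
  by move=> /lines_line_of; rewrite prednK//; lia.
have xiE j : (1 <= j <= n)%N -> line_of xi j = chain n 0 j.
  move=> jn; have [->|jn'] := eqVneq j n; last by rewrite exi//; lia.
  by rewrite cn line_of_default//; lia.
have xid : xi_decreasing xi.
  by apply/xi_decreasingP => j jn; rewrite !xiE; [apply: cl.1; lia|lia|lia].
have gE j : (j < n)%N -> gap a (line_of xi) j = gap a (chain n 0) j.
  case: j => [|j] jn; rewrite /gap /top /= -?[nth _ _ _]/(line_of xi _.+1);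
    by rewrite ?xiE //; lia.
have en : energy a d w (line_of xi) n = energy a d w (chain n 0) n.
  rewrite /energy; congr (- _ + _ * _); apply: eq_big_nat => j jn.
    by rewrite gE//; lia.
  by rewrite xiE//; lia.
have lt (eta : n.-1.-tuple R) : xi_decreasing eta ->
    (exists2 i, (1 <= i < n)%N & chain n 0 i != line_of eta i) ->
    dirichlet_energy u_ a k d xi < dirichlet_energy u_ a k d eta.
  move=> etad ne; rewrite !dirichlet_energyE// en.
  apply: (energy_lt S nm cl cs (lin _ etad)) => //.
  by rewrite cn line_of_default//; lia.
have xim : is_min_point u_ a k d xi.
  split=> // eta etad.
  have [[j jn ne]|eq] := pselect (exists2 i, (1 <= i < n)%N & chain n 0 i != line_of eta i).
    by apply/ltW/lt => //; exists j.
  have eeq j : (1 <= j < n)%N -> line_of eta j = line_of xi j.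
    move=> jn; rewrite exi//; apply/eqP/negP => /negP ne; apply: eq.
    by exists j => //; rewrite eq_sym.
  suff -> : eta = xi by [].
  apply: eq_from_tnth => j; rewrite !(tnth_nth 0).
  exact: (eeq j.+1 ltac:(have := ltn_ord j; lia)).
have [md mm] : is_min_point u_ a k d (min_point u_ a k d n).
  rewrite /min_point; case: xgetP => [y _ /=|nx]; [by []|by case: (nx xi)].
apply/eqP/negP => /negP ne.
have := mm xi xid; rewrite leNgt => /negP; apply; apply: lt => //.
by exists i => //; rewrite eq_sym.
Qed.

(** With the minimum point identified, gamma_{n+1} is the shooting flux at 0. *)
Lemma gammaE n : (n < m)%N -> gamma m u_ a k d n.+1 = (flux n 0)%:E.
Proof.
move=> nm; have nm' : (1 <= n.+1 <= m)%N by lia.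
have [cl cs] := chain_system S nm' (lexx 0).
have c0 : 0 < a n by apply: ha; lia.
have cn : chain n.+1 0 n.+1 = 0 by rewrite chain_last.
have := system_flux S (n := n.+1) nm cl cs (ltnSn n).
rewrite cn => <-; rewrite /gamma /= nm; congr EFin.
have -> : Fdiv (a n) (xi_ext (min_point u_ a k d n.+1) n) = gap a (chain n.+1 0) n.
  rewrite /gap cn Phi0 subr0 /top; case: n nm nm' c0 {cl cs cn} => [//|n] nm nm' c0.
  have mp := min_point_chain (n := n.+2) (i := n.+1) ltac:(lia) ltac:(lia).
  rewrite xi_extS mp.
  have [cl cs] := chain_system S nm' (lexx 0).
  by rewrite FdivE//; apply: (lines_ge0 cl); lia.
rewrite phi_at0 -[RHS]mulrA -invfM//.
Qed.

Lemma gammaSm : gamma m u_ a k d m.+1 = +oo%E.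
Proof. by rewrite /gamma ltnn. Qed.

(** The algebraic problem equivalent to the existence of a solution of type n:
    [nd_neumann] is the Stefan condition on the last line, where the warmer phase
    obeys the Neumann condition, and [nd_top] says u(0) <= u_{n+1}. *)
Record neumann_data (n : nat) (x : nat -> R) : Prop := {
  nd_default : forall i, (i == 0%N) || (n < i)%N -> x i = 0 ;
  nd_lines : forall i, (1 <= i <= n)%N -> x i.+1 < x i ;
  nd_stefan : system a d w x n ;
  nd_neumann : (1 <= n)%N ->
    d n * x n / 2 + w n.-1 * phi (a n.-1) (x n) / gap a x n.-1
    = amplitude a n b * phi (a n) (x n) ;
  nd_top : (n < m)%N -> amplitude a n b * top a x n <= w n }.

Lemma data_lines n x : neumann_data n x -> lines x n /\ ((1 <= n)%N -> 0 < x n).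
Proof.
move=> D; have xn : (1 <= n)%N -> 0 < x n.
  move=> n1; rewrite -(nd_default D (i := n.+1)) ?ltnSn ?orbT//.
  by apply: (nd_lines D); lia.
split=> //; split; first by move=> i ni; apply: (nd_lines D); lia.
by have [->|n0] := posnP n; [rewrite (nd_default D)|exact/ltW/xn].
Qed.

Lemma data_warm n x : (n < m)%N -> neumann_data n.+1 x ->
  warm_flux a d w n (x n.+1) = amplitude a n.+1 b * phi (a n.+1) (x n.+1).
Proof.
move=> nm D; have [xl _] := data_lines D.
have := system_flux S (n := n.+1) nm xl (nd_stefan D) (ltnSn n).
by move=> e; rewrite -(nd_neumann D)//= e addrC.
Qed.

Lemma data_gamma n x : (n <= m)%N -> neumann_data n x ->
  (gamma m u_ a k d n < b%:E)%E /\ (b%:E <= gamma m u_ a k d n.+1)%E.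
Proof.
case: n => [|n] nm D.
  split; first by rewrite /gamma eqxx lte_fin.
  rewrite gammaE// lee_fin /= phi_at0 Phi0 subr0 divr1.
  by have := nd_top D hm; rewrite /top /amplitude eqxx mulr1 ler_pdivlMr// mulr_gt0 ?sqrtpi_gt0 ?ha.
have [_ /(_ isT) y0] := data_lines D.
have e := data_warm nm D.
split.
  by rewrite gammaE// lte_fin; exact: (neumann_root_flux S nm b0 y0 e).
move: nm; rewrite leq_eqVlt => /predU1P[nm|nm].
  by rewrite nm gammaSm leey.
rewrite gammaE// lee_fin.
by apply/(neumann_top S nm b0 y0 e); exact: (nd_top D nm).
Qed.

Lemma data_unique n x z : (n <= m)%N -> neumann_data n x -> neumann_data n z -> x = z.
Proof.
move=> nm D D'; apply/funext => i.
have [out|] := boolP ((i == 0%N) || (n < i)%N).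
  by rewrite (nd_default D)// (nd_default D').
rewrite negb_or -leqNgt => /andP[i0 ni].
case: n nm D D' ni => [|n] nm D D' ni; first lia.
have [xl /(_ isT) x0] := data_lines D; have [zl /(_ isT) z0] := data_lines D'.
have e := neumann_root_unique S nm b0 x0 z0 (data_warm nm D)
  (data_warm nm D').
apply: (system_unique S nm xl (nd_stefan D) zl (nd_stefan D') e).
lia.
Qed.

Lemma data_exists n : (n <= m)%N ->
  (gamma m u_ a k d n < b%:E)%E -> (b%:E <= gamma m u_ a k d n.+1)%E ->
  exists x, neumann_data n x.
Proof.
case: n => [|n] nm.
  move=> _; rewrite gammaE// lee_fin /= phi_at0 Phi0 subr0 divr1.
  rewrite ler_pdivlMr ?mulr_gt0 ?sqrtpi_gt0 ?ha// => h.
  exists (fun=> 0); split => //; try by [move=> i; lia].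
  by rewrite /top /= mulr1.
rewrite gammaE// lte_fin => lt le.
have [y y0 ey] := neumann_root_exists S nm lt.
have nm' : (1 <= n.+1 <= m)%N by lia.
have [cl cs] := chain_system S nm' (ltW y0).
have cn : chain n.+1 y n.+1 = y by rewrite chain_last.
pose x i := if (i == 0%N) || (n.+1 < i)%N then 0 else chain n.+1 y i.
have xE i : (1 <= i <= n.+1)%N -> x i = chain n.+1 y i.
  by move=> ni; rewrite /x ifF//; lia.
have xlast : x n.+2 = 0 by rewrite /x ltnSn orbT.
have gE j : (j <= n)%N -> gap a x j = gap a (chain n.+1 y) j.
  by case: j => [|j] jn; rewrite /gap /top /= !xE//; lia.
exists x; split.
- by move=> i; rewrite /x => ->.
- move=> i ni; rewrite [ltRHS]xE//.
  have [->|ne] := eqVneq i n.+1; first by rewrite xlast cn.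
  by rewrite xE; [apply: cl.1; lia|lia].
- move=> i ni; rewrite /stefan !gE; try lia.
  by rewrite xE; [apply: cs|lia].
- move=> _; rewrite gE// xE ?cn; last lia.
  rewrite -ey /warm_flux /=.
  have := system_flux S (n := n.+1) nm cl cs (ltnSn n).
  by rewrite cn => ->; rewrite addrC.
- move=> nm2; rewrite /top /= xE ?cn; last lia.
  move: le; rewrite gammaE// lee_fin.
  by move/(neumann_top S nm2 b0 y0 ey).
Qed.

(** The coefficients s_i of the profile: they are forced by the temperatures of the
    two lines bounding the phase and, in phase n, by the Neumann condition. *)
Definition slope n x i :=
  if (i < n)%N then (u_ i.+1 - u_ i) / gap a x i else amplitude a n b / k n.

Lemma slope_flux n x i : (n <= m)%N -> (i < n)%N -> k i * slope n x i = w i / gap a x i.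
Proof. by move=> nm ni; rewrite /slope ni mulrA. Qed.

Lemma slope_last n x : (n <= m)%N -> k n * slope n x n = amplitude a n b.
Proof. by move=> nm; rewrite /slope ltnn mulrC divfK// gt_eqF// hk. Qed.

Lemma data_profile n x U : (n <= m)%N ->
  x n.+1 = 0 -> (forall i, (1 <= i <= n)%N -> x i.+1 < x i) ->
  ((n < m)%N -> amplitude a n b * top a x n <= w n) ->
  (forall i z, (i <= n)%N -> zone x i z ->
    U z = u_ i + slope n x i * (top a x i - Phi (a i) z)) ->
  (forall i, (1 <= i <= n)%N -> U (x i) = u_ i) ->
  melting_profile m n u_ a x (slope n x) U.
Proof.
move=> nm xlast xd xt UE UL; split=> //.
- move=> i ni; rewrite /slope ni divfK// gt_eqF//.
  suff xl : lines x n by exact: (gap_gt0 ha nm xl ni).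
  split; first by move=> j nj; apply: xd; lia.
  by apply/ltW; rewrite -xlast; apply: xd; lia.
- by rewrite /slope ltnn divr_gt0// ?(amplitude_gt0 S)// hk.
- move=> nm'; rewrite /slope ltnn mulrAC ler_pdivrMr ?hk// mulrC mulrC.
  by rewrite [leRHS]mulrC; exact: xt.
Qed.

Lemma flip_ratio (A B p q r : R) :
  A + B / (q - p) * (r - p) = A + B / (p - q) * (p - r).
Proof. by rewrite -(opprB p q) invrN -(opprB p r) [B * - _]mulrN mulrNN. Qed.

Lemma profile_zone n (xi : n.-tuple R) U i z : (n <= m)%N ->
  profile_form u_ a k bN xi U -> (i <= n)%N -> zone (line_of xi) i z ->
  U z = u_ i + slope n (line_of xi) i * (top a (line_of xi) i - Phi (a i) z).
Proof.
move=> nm pf ni zi; have xid := pf_decreasing pf.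
have c0 : 0 < a i by apply: ha; lia.
have [h1 h2] := (zoneP xi i z).1 zi.
have z0 : 0 < z by apply: le_lt_trans zi.1; exact: line_of_ge0.
move: ni; rewrite leq_eqVlt => /predU1P[e|ni].
  subst i; rewrite (pf_last pf z0 h2) FdivE ?ltW// Fdiv_top// /slope ltnn /amplitude /b.
  by field; rewrite gt_eqF// hk.
rewrite (pf_inner pf ni h1 h2) [Fdiv _ z%:E]FdivE ?ltW// Fdiv_top//.
rewrite xi_extS FdivE//; last exact: line_of_ge0.
rewrite /slope ni.
by rewrite /gap flip_ratio.
Qed.

Lemma profile_limit n (x : nat -> R) U : x n.+1 = 0 ->
  ((1 <= n)%N -> 0 < x n) ->
  (forall z, zone x n z -> U z = u_ n + slope n x n * (top a x n - Phi (a n) z)) ->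
  U z @[z --> 0^'+] --> u_ n + slope n x n * top a x n.
Proof.
move=> xlast xn UE.
have -> : u_ n + slope n x n * top a x n = zone_formula u_ a x (slope n x) n 0.
  by rewrite /zone_formula Phi0 subr0.
have c := cvg_at_right_filter (@zone_formula_cont _ u_ a x (slope n x) n 0).
apply: cvg_near_eq c; have zr : \forall y \near 0^'+, zone x n y.
  apply: zone_right; first by rewrite xlast.
  by have [n0|n0] := posnP n; [left|right; exact: xn].
by apply: filterS zr => y /UE.
Qed.

Lemma solution_data n v : self_similar_solution m u_ a k d alpha bN n v ->
  exists x U, [/\ neumann_data n x, melting_profile m n u_ a x (slope n x) U &
    forall t y, 0 < t -> 0 < y -> v t y = U (y / Num.sqrt t)].
Proof.
move=> [nm sol [U [U0 [xi [hv hU0 [_ U0t] pf]]]]].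
have xid := pf_decreasing pf.
pose x := line_of xi.
have xlast : x n.+1 = 0 by rewrite /x line_of_default.
have xd i : (1 <= i <= n)%N -> x i.+1 < x i by apply: (xi_decreasingP xi).1.
have UE i z : (i <= n)%N -> zone x i z ->
    U z = u_ i + slope n x i * (top a x i - Phi (a i) z) by exact: profile_zone.
have UL i : (1 <= i <= n)%N -> U (x i) = u_ i.
  by move=> ni; apply: (pf_lines pf ni); case: i ni => // i ni; rewrite xi_extS.
have xn : (1 <= n)%N -> 0 < x n by move=> n1; rewrite -xlast xd//; lia.
have U0E : U0 = u_ n + slope n x n * top a x n.
  apply: (cvg_unique (@Rhausdorff R) hU0).
  by apply: profile_limit => // z; exact: UE.
have xt : (n < m)%N -> amplitude a n b * top a x n <= w n.
  move=> nm'; move: U0t; rewrite /temp nm' lee_fin U0E.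
  rewrite -lerBrDl /slope ltnn mulrAC ler_pdivrMr ?hk//.
  by rewrite [leRHS]mulrC.
have P := data_profile nm xlast xd xt UE UL.
exists x, U; split=> //.
have bal := balance_of_solution P hv sol.
split=> //.
- move=> i /orP[/eqP ->//|ni]; exact: line_of_default.
- move=> i ni; have := bal i ltac:(lia); rewrite /flux_balance /stefan.
  rewrite !slope_flux; try lia.
  by rewrite ![_ / _ * phi _ _]mulrAC => h; lra.
- move=> n1; have := bal n ltac:(lia); rewrite /flux_balance.
  rewrite slope_last// slope_flux; try lia.
  by rewrite ![_ / _ * phi _ _]mulrAC => h; lra.
Qed.

(** Phases are tried from the warm end, and each line belongs to its warmer side. *)
Fixpoint glue (V : nat -> R -> R) (x : nat -> R) i z :=
  if i is j.+1 then if z <= x i then V i z else glue V x j z else V 0 z.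

Lemma glueE V x n i z : (forall i, (1 <= i <= n)%N -> x i.+1 < x i) ->
  (i <= n)%N -> x i.+1 < z -> (i = 0%N \/ z <= x i) -> glue V x n z = V i z.
Proof.
move=> + + xz zx; elim: n => [|n IH] xd ni /=.
  by have -> : i = 0%N by lia.
have [e|ne] := eqVneq i n.+1.
  by rewrite -e; case: zx => [|->//]; lia.
have le : forall j, (i < j <= n.+1)%N -> x j <= x i.+1.
  elim=> // j IHj ij; have [->//|nj] := eqVneq i j.
  by apply: le_trans (IHj _); [apply/ltW/xd; lia|lia].
rewrite leNgt (le_lt_trans (le n.+1 _) xz) /=; last lia.
by apply: IH; [move=> j jn; apply: xd; lia|lia].
Qed.

Lemma data_solution n x : (n <= m)%N -> neumann_data n x ->
  exists v, self_similar_solution m u_ a k d alpha bN n v.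
Proof.
move=> nm D.
pose U := glue (zone_formula u_ a x (slope n x)) x n.
have xlast : x n.+1 = 0 by rewrite (nd_default D)// ltnSn orbT.
have xd := nd_lines D.
have xn := (data_lines D).2.
have UE i z : (i <= n)%N -> zone x i z ->
    U z = u_ i + slope n x i * (top a x i - Phi (a i) z).
  move=> ni [xz zx]; rewrite /U (glueE _ xd ni xz)//.
  by case: zx => [|/ltW]; [left|right].
have UL i : (1 <= i <= n)%N -> U (x i) = u_ i.
  move=> ni; rewrite /U (@glueE _ _ n i)//; [|lia|by apply: xd|by right].
  by rewrite /zone_formula /top; case: eqP => [|_]; [lia|rewrite subrr mulr0 addr0].
have P := data_profile nm xlast xd (nd_top D) UE UL.
have [xi xiE] : exists xi : n.-tuple R, line_of xi = x.
  exists [tuple x i.+1 | i < n]; apply/funext => i.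
  have [ni|ni] := ltnP n i.
    by rewrite line_of_default// (nd_default D)// ni orbT.
  case: i ni => [|i] ni; first by rewrite (nd_default D).
  by rewrite /= (nth_map (Ordinal ni)) ?size_enum_ord// nth_enum_ord.
pose v t y := U (y / Num.sqrt t).
have hv t y : 0 < t -> 0 < y -> v t y = U (y / Num.sqrt t) by [].
exists v; split=> //.
  apply: (solution_of_balance P hv halpha).
    move=> i ni; rewrite /flux_balance.
    move: ni => /andP[i1]; rewrite leq_eqVlt => /predU1P[e|ni].
      subst i; have := nd_neumann D i1.
      rewrite slope_last// slope_flux; try lia.
      by rewrite ![_ / _ * phi _ _]mulrAC => h; lra.
    have := nd_stefan D (i := i) ltac:(lia); rewrite /stefan.
    rewrite !slope_flux; try lia.
    by rewrite ![_ / _ * phi _ _]mulrAC => h; lra.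
  rewrite mulrA slope_last// /amplitude phi_at0 -/b mulfK//.
  by rewrite gt_eqF// mulr_gt0 ?sqrtpi_gt0 ?ha.
exists U, (u_ n + slope n x n * top a x n), xi.
have xid : xi_decreasing xi by apply/xi_decreasingP; rewrite xiE.
have sn0 : 0 < slope n x n by exact: (mp_slope_last P).
have tn0 : 0 < top a x n.
  rewrite /top; case: eqP => // /eqP n0.
  by rewrite -(Phi0 (a n)) Phi_lt ?ha ?xn//; lia.
split=> //.
- by apply: profile_limit => // z; exact: UE.
- split; first by rewrite /temp nm lte_fin ltrDl mulr_gt0.
  rewrite /temp; case: ifP => nm'; last by rewrite leey.
  by rewrite lee_fin -lerBrDl; exact: (mp_slope_top P).
- have inv i z : (i <= n)%N -> (xi_ext xi i.+1 < z%:E)%E -> (z%:E < xi_ext xi i)%E ->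
    [/\ 0 < z, 0 < a i & U z = u_ i + slope n x i * (top a x i - Phi (a i) z)].
    move=> ni h1 h2; have zi : zone x i z by rewrite -xiE; apply/zoneP.
    split; [exact: (zone_gt0 P ni zi)|by apply: ha; lia|exact: UE].
  split=> //.
  + move=> i z ni h1 h2; have [z0 c0 ->] := inv i z (ltnW ni) h1 h2.
    rewrite [Fdiv _ z%:E]FdivE ?ltW// Fdiv_top//.
    rewrite xi_extS FdivE//; last exact: line_of_ge0.
    rewrite xiE /slope ni.
    by rewrite /gap flip_ratio.
  + move=> z z0 h2; have [|_ c0 ->] := inv n z (leqnn n) _ h2.
      by rewrite xi_extS xiE xlast lte_fin.
    rewrite FdivE ?ltW// Fdiv_top// xiE /slope ltnn /amplitude /b.
    by field; rewrite gt_eqF// hk.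
  + move=> i z ni; case: i ni => // i ni; rewrite xi_extS xiE => -[<-].
    exact: UL.
Qed.

Lemma gamma_mono i j : (1 <= i <= j)%N -> (j <= m.+1)%N ->
  (gamma m u_ a k d i <= gamma m u_ a k d j)%E.
Proof.
move=> /andP[i1]; elim: j => [|j IH] ij jm; first lia.
have [->//|ne] := eqVneq i j.+1.
apply: (le_trans (IH _ _)); try lia.
have [->|jm'] := eqVneq j m; first by rewrite gammaSm leey.
have [j' ej] : exists j', j = j'.+1 by exists j.-1; lia.
subst j; rewrite !gammaE; try lia.
by rewrite lee_fin; apply: (flux_at0_le S); lia.
Qed.

(** The intervals ]gamma_n, gamma_{n+1}] are disjoint because gamma is
    nondecreasing from index 1 on. *)
Lemma type_unique n n' : (n <= m)%N -> (n' <= m)%N ->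
  (gamma m u_ a k d n < b%:E)%E -> (b%:E <= gamma m u_ a k d n.+1)%E ->
  (gamma m u_ a k d n' < b%:E)%E -> (b%:E <= gamma m u_ a k d n'.+1)%E -> n = n'.
Proof.
have lt i j : (i <= m)%N -> (j <= m)%N -> (gamma m u_ a k d j < b%:E)%E ->
    (b%:E <= gamma m u_ a k d i.+1)%E -> (j <= i)%N.
  move=> im jm lt le; rewrite leqNgt; apply/negP => ij.
  have := le_trans le (gamma_mono (i := i.+1) (j := j) ltac:(lia) ltac:(lia)).
  by rewrite leNgt lt.
move=> nm nm' l1 l2 l1' l2'; apply/eqP; rewrite eqn_leq.
by rewrite (lt n' n)// (lt n n').
Qed.

(** The first n with b <= gamma_{n+1}; gamma_{m+1} = +oo and gamma_0 = 0 < b. *)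
Lemma type_exists : exists n, [/\ (n <= m)%N, (gamma m u_ a k d n < b%:E)%E &
  (b%:E <= gamma m u_ a k d n.+1)%E].
Proof.
have ex : exists n, (b%:E <= gamma m u_ a k d n.+1)%E by exists m; rewrite gammaSm leey.
case: (ex_minnP ex) => n bn min_n; exists n; split=> //.
  by apply: min_n; rewrite gammaSm leey.
case: n bn min_n => [|n] bn min_n; first by rewrite /gamma eqxx lte_fin.
by rewrite ltNge; apply/negP => /min_n; lia.
Qed.

Lemma self_similar_unique n v v' : self_similar_solution m u_ a k d alpha bN n v ->
  self_similar_solution m u_ a k d alpha bN n v' ->
  forall t y, 0 < t -> 0 < y -> v' t y = v t y.
Proof.
move=> Sv Sv'; have nm : (n <= m)%N by case: Sv.
have [x [U [D P hv]]] := solution_data Sv.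
have [x' [U' [D' P' hv']]] := solution_data Sv'.
have e := data_unique nm D D'; subst x'.
move=> t y t0 y0; rewrite hv// hv'//.
have z0 : 0 < y / Num.sqrt t by rewrite divr_gt0 ?sqrtr_gt0.
have [i ni [zi|[i0 ->]]] := zone_or_line P z0.
  by rewrite (mp_zone P ni zi) (mp_zone P' ni zi).
by rewrite (mp_line P) ?(mp_line P')//; lia.
Qed.

Lemma solution_type n v : self_similar_solution m u_ a k d alpha bN n v ->
  [/\ (n <= m)%N, (gamma m u_ a k d n < b%:E)%E &
    (b%:E <= gamma m u_ a k d n.+1)%E].
Proof.
move=> Sv; have nm : (n <= m)%N by case: Sv.
by have [x [U [D _ _]]] := solution_data Sv; have [] := data_gamma nm D.
Qed.

Lemma solution_exists n : (n <= m)%N -> (gamma m u_ a k d n < b%:E)%E ->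
  (b%:E <= gamma m u_ a k d n.+1)%E ->
  exists v, self_similar_solution m u_ a k d alpha bN n v.
Proof.
move=> nm lt le; have [x D] := data_exists nm lt le.
exact: (data_solution nm D).
Qed.

End Problem.

(** * Existence, uniqueness and type of the self-similar solution *)

Theorem theorem3p2 (R : realType) (m : nat) (u_ a k d : nat -> R)
    (alpha : R -> R) (bN : R)
    (hm : (1 <= m)%N)
    (hu01 : u_ 0%N <= u_ 1%N)
    (hu : forall i, (1 <= i < m)%N -> u_ i < u_ i.+1)
    (ha : forall i, (i <= m)%N -> 0 < a i)
    (hk : forall i, (i <= m)%N -> 0 < k i)
    (hd : forall i, (1 <= i <= m)%N -> 0 <= d i)
    (hd1 : u_ 0%N = u_ 1%N -> 0 < d 1%N)
    (halpha : is_alpha m u_ k alpha)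
    (hbN : bN < 0) :
  (exists (n : nat) (u : R -> R -> R),
     self_similar_solution m u_ a k d alpha bN n u /\
     (forall (n' : nat) (v : R -> R -> R),
        self_similar_solution m u_ a k d alpha bN n' v ->
        n' = n /\ forall t x : R, 0 < t -> 0 < x -> v t x = u t x)) /\
  (forall n : nat, (n <= m)%N ->
     (exists u : R -> R -> R,
        self_similar_solution m u_ a k d alpha bN n u) <->
     ((gamma m u_ a k d n < (- bN)%:E)%E /\
      ((- bN)%:E <= gamma m u_ a k d n.+1)%E)).
Proof.
have A : admissible m u_ a k d by split.
split; last first.
  move=> n nm; split=> [[u Su]|[lt le]]; last exact: (solution_exists A).
  by have [_ lt le] := solution_type A hbN Su.
have [n [nm lt le]] := type_exists A hbN.
have [u Su] := solution_exists A halpha hbN nm lt le; exists n, u; split=> // n' v Sv.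
have [nm' lt' le'] := solution_type A hbN Sv.
have e := type_unique A hbN nm' nm lt' le' lt le; subst n'.
split=> //; exact: (self_similar_unique A hbN Su Sv).
Qed.
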